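(* Let $|\arg(z)|<\pi$. Then as $z\to\infty$, \begin{align*} \psi_1(z)\sim{1\over 2}\log^2(z)-{1 \over 2z}\log z+\sum_{k=1}^{\infty}{B_{2k}\over 2kz^{2k}} \left(\sum_{j=1}^{2k-2}{1\over j}+{1\over 2k-1}-\log z \right). \end{align*}
   Context: $\log$ is the principal branch of the logarithm and $B_{m}$ are the Bernoulli numbers; an empty sum (for $k=1$) is zero. $\gamma_1=\lim_{n\to\infty}\left(\sum_{j=1}^{n}\frac{\log(j)}{j}-\frac{\log^{2}(n)}{2}\right)$ is the first Stieltjes constant, and for $z\in\mathbb{C}\setminus(-\infty,0]$, $\psi_1(z)=-\gamma_1-\frac{\log(z)}{z}-\sum_{n=1}^{\infty}\left(\frac{\log(n+z)}{n+z}-\frac{\log(n)}{n}\right)$. The symbol $\sim$ denotes an asymptotic expansion in the Poincaré sense. *)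

(* Defs.v *)
From Stdlib Require Import Reals Lra Lia Arith.
From Coquelicot Require Import Coquelicot.

Open Scope R_scope.

(** * Complex logarithm *)

(* For [z <> 0] this is the argument in [(-PI, PI]]; the value at 0 is junk. *)
Definition Carg (z : C) : R :=
  if Rle_dec 0 (Im z) then acos (Re z / Cmod z) else - acos (Re z / Cmod z).

Definition Clog (z : C) : C := (ln (Cmod z), Carg z).

Lemma Carg_bound (z : C) : - PI <= Carg z <= PI.
Proof.
unfold Carg.
pose proof (acos_bound (Re z / Cmod z)).
destruct (Rle_dec 0 (Im z)); lra.
Qed.

Lemma Carg_polar (z : C) : z <> 0 ->
  z = (Cmod z * cos (Carg z), Cmod z * sin (Carg z)).
Proof.
intros Hz.
assert (Hm : 0 < Cmod z) by now apply Cmod_gt_0.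
assert (Hsq : Cmod z ^ 2 = Re z ^ 2 + Im z ^ 2).
{ unfold Cmod; rewrite pow2_sqrt; [reflexivity|].
  destruct z as [x y]; simpl; nra. }
assert (Hc : -1 <= Re z / Cmod z <= 1).
{ pose proof (re_le_Cmod z) as H; apply Rabs_le_between in H.
  split; [apply Rle_div_r | apply Rle_div_l]; lra. }
assert (Hs : Cmod z * sin (acos (Re z / Cmod z)) = Rabs (Im z)).
{ rewrite sin_acos by exact Hc.
  rewrite <- (sqrt_Rsqr (Cmod z)) at 1 by lra.
  rewrite <- sqrt_mult_alt by apply Rle_0_sqr.
  rewrite <- sqrt_Rsqr_abs; f_equal.
  unfold Rsqr in *; field_simplify; [rewrite Hsq; ring | lra]. }
assert (Hcos : Cmod z * cos (acos (Re z / Cmod z)) = Re z).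
{ rewrite cos_acos by exact Hc; field; lra. }
unfold Carg; destruct (Rle_dec 0 (Im z)) as [Hi|Hi].
- rewrite Hcos, Hs, Rabs_pos_eq by exact Hi.
  now destruct z.
- rewrite cos_neg, sin_neg, Hcos, Ropp_mult_distr_r_reverse, Hs.
  rewrite Rabs_left, Ropp_involutive by lra.
  now destruct z.
Qed.

(** * Bernoulli numbers *)

(* [bernoulli_upto n k] is the [k]-th Bernoulli number for [k <= n]. *)
Fixpoint bernoulli_upto (n : nat) : nat -> R :=
  match n with
  | O => fun _ => 1
  | S m => fun k =>
      if (k <=? m)%nat then bernoulli_upto m k
      else - sum_f_R0 (fun j => Binomial.C (m + 2) j * bernoulli_upto m j) m
           / INR (m + 2)
  end.

Definition bernoulli (n : nat) : R := bernoulli_upto n n.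

Lemma bernoulli_upto_eq (n k : nat) :
  (k <= n)%nat -> bernoulli_upto n k = bernoulli k.
Proof.
induction n as [|n IH]; intros Hk.
- now replace k with 0%nat by lia.
- destruct (Nat.eq_dec k (S n)) as [->|Hne]; [reflexivity|].
  simpl; rewrite (proj2 (Nat.leb_le k n)) by lia.
  apply IH; lia.
Qed.

Lemma bernoulli_0 : bernoulli 0 = 1.
Proof. reflexivity. Qed.

Lemma bernoulli_rec (n : nat) : (1 <= n)%nat ->
  sum_f_R0 (fun j => Binomial.C (n + 1) j * bernoulli j) n = 0.
Proof.
destruct n as [|m]; [lia|intros _].
rewrite tech5.
replace (S m + 1)%nat with (m + 2)%nat by lia.
assert (HC : Binomial.C (m + 2) (S m) = INR (m + 2)).
{ unfold Binomial.C.
  replace (m + 2 - S m)%nat with 1%nat by lia.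
  replace (m + 2)%nat with (S (S m)) by lia.
  rewrite (fact_simpl (S m)), mult_INR; simpl (fact 1); simpl (INR 1).
  field; apply INR_fact_neq_0. }
rewrite HC; unfold bernoulli at 2; cbn [bernoulli_upto].
rewrite (proj2 (Nat.leb_gt (S m) m)) by lia.
rewrite (sum_eq (fun j => Binomial.C (m + 2) j * bernoulli_upto m j)
           (fun j => Binomial.C (m + 2) j * bernoulli j) m).
2: { intros i Hi; now rewrite bernoulli_upto_eq. }
field; apply not_0_INR; lia.
Qed.

(** * The function [psi_1] *)

Definition gamma1 : R :=
  real (Lim_seq (fun n =>
    sum_n_m (fun j => ln (INR j) / INR j) 1 n - ln (INR n) ^ 2 / 2)).

Definition CSeries (a : nat -> C) : C :=
  (Series (fun n => Re (a n)), Series (fun n => Im (a n))).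

Lemma CSeries_unique (a : nat -> C) (l : C) : is_series a l -> CSeries a = l.
Proof.
intros H.
assert (Hn := proj1 (filterlim_locally_ball_norm _ _) H).
assert (Hsum : forall n, Re (sum_n a n) = sum_n (fun k => Re (a k)) n
                      /\ Im (sum_n a n) = sum_n (fun k => Im (a k)) n).
{ induction n as [|n [IHr IHi]].
  - now split; rewrite !sum_O.
  - rewrite (sum_Sn a), (sum_Sn (fun k => Re (a k))), (sum_Sn (fun k => Im (a k))).
    split; [rewrite <- IHr | rewrite <- IHi]; reflexivity. }
assert (Hball : forall (eps : posreal) n, ball_norm l eps (sum_n a n) ->
  Cmod (sum_n a n - l)%C < eps) by (intros eps n Hb; exact Hb).
assert (Him : forall c : C, Rabs (Im c) <= Cmod c).
{ intros c; unfold Cmod; rewrite <- sqrt_Rsqr_abs; apply sqrt_le_1_alt.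
  unfold Rsqr, Im; nra. }
rewrite (surjective_pairing l); unfold CSeries; f_equal;
  apply is_series_unique; apply filterlim_locally; intros eps;
  generalize (Hn eps); apply filter_imp; intros n Hb; apply Hball in Hb.
- apply (eq_ind _ (fun s => Rabs (s - Re l) < eps)) with (2 := proj1 (Hsum n)).
  exact (Rle_lt_trans _ _ _ (re_le_Cmod (sum_n a n - l)%C) Hb).
- apply (eq_ind _ (fun s => Rabs (s - Im l) < eps)) with (2 := proj2 (Hsum n)).
  exact (Rle_lt_trans _ _ _ (Him (sum_n a n - l)%C) Hb).
Qed.

(* [Series] in Coquelicot start at 0, hence the shift [S n]. *)
Definition psi1 (z : C) : C :=
  (- RtoC gamma1 - Clog z / z
   - CSeries (fun n => Clog (RtoC (INR (S n)) + z) / (RtoC (INR (S n)) + z)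
                       - Clog (RtoC (INR (S n))) / RtoC (INR (S n))))%C.

(** * Asymptotic expansions *)

(* [is_domin F f g] is [g = o(f)] along [F].  The terms [u n] are themselves
   the asymptotic scale. *)
Definition asymptotic_expansion {T : Type} {K : AbsRing} {V : NormedModule K}
    (F : (T -> Prop) -> Prop) (f : T -> V) (u : nat -> T -> V) : Prop :=
  (forall n : nat, is_domin F (u n) (u (S n))) /\
  (forall N : nat,
     is_domin F (u N) (fun x => minus (f x) (sum_n (fun n => u n x) N))).

Definition C_infty : (C -> Prop) -> Prop :=
  fun P => exists M : R, forall z : C, M < Cmod z -> P z.

(* Estimates along this filter are uniform in [Carg z]. *)
Definition sector_infty (alpha : R) : (C -> Prop) -> Prop :=
  within (fun z : C => Rabs (Carg z) <= alpha) C_infty.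

Definition psi1_term (n : nat) (z : C) : C :=
  match n with
  | 0%nat => (RtoC (1 / 2)%R * Clog z ^ 2)%C
  | 1%nat => (- (RtoC 1 / (RtoC 2 * z) * Clog z))%C
  | S k =>
      (RtoC (bernoulli (2 * k)) / (RtoC (INR (2 * k)) * z ^ (2 * k))
       * (RtoC (sum_n_m (fun j => 1 / INR j) 1 (2 * k - 2)
                  + 1 / INR (2 * k - 1))%R - Clog z))%C
  end.

(* Main.v *)
(** With G = log^2/2 and F = G' = log w / w, the Euler-Maclaurin sum
    A_M(w) = sum_(k <= M) B_k/k! G^(k)(w) almost solves A_M(w+1) - A_M(w) = F(w):
    after Taylor expanding every G^(k)(w+1) at w, the recurrence of the Bernoulli
    numbers cancels all terms but G'(w), and the defect is bounded by G^(M+2) on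
    [w, w+1].  Summing over w = z, z+1, z+2, ... and comparing with log^2(n)/2 gives
    psi_1(z) = A_M(z) + (sum of the defects at z + j), first at z = 1 for gamma_1.
    In the sector |z + t| >= c (|z| + t), so the sum of defects is O(|z|^(-M)).

    The terms can only serve as an asymptotic scale because no B_2k vanishes.  This
    and B_(2k+1) = 0 come from Rolle's theorem and the reflection x -> 1 - x for the
    Bernoulli polynomials: B_(2k+1)(x) has no zero in (0, 1/2). *)

Require Import Defs.
From Stdlib Require Import Reals Lra Lia Arith.
From Coquelicot Require Import Coquelicot.

Open Scope R_scope.


(** * Bernoulli numbers *)

Lemma mean_value (f f' : R -> R) (a b : R) :
  (forall x, is_derive f x (f' x)) -> a < b ->
  exists c, a < c < b /\ f b - f a = f' c * (b - a).
Proof.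
intros Df Hab.
destruct (MVT_cor2 f f' a b Hab) as [c [E Hc]].
{ intros c _; apply is_derive_Reals, Df. }
now exists c.
Qed.

(** Zeros are counted with this form of Rolle's theorem: two zeros of a polynomial force a zero of
    its derivative strictly between them. *)
Lemma rolle (f f' : R -> R) (a b : R) :
  (forall x, is_derive f x (f' x)) -> a < b -> f a = f b ->
  exists c, a < c < b /\ f' c = 0.
Proof.
intros Df Hab E.
destruct (mean_value f f' a b Df Hab) as [c [Hc Ec]].
exists c; split; [exact Hc|].
assert (P : f' c * (b - a) = 0) by lra.
apply Rmult_integral in P; lra.
Qed.

(** The difference [p n] of the two sides satisfies p_(n+1)' = -p_n. If p_n = 0 then p_(n+1) is
    constant. The constant is 0 because p_(n+2), whose slope is its negative, takes equal values at
    0 and 1 by periodicity. *)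
Lemma appell_reflection (beta : nat -> R -> R) :
  (forall x, beta 0%nat x = 1) ->
  (forall n x, is_derive (beta (S n)) x (beta n x)) ->
  (forall n, (2 <= n)%nat -> beta n 0 = beta n 1) ->
  forall n x, beta n (1 - x) = (-1) ^ n * beta n x.
Proof.
intros H0 HD Hper.
set (p := fun n x => beta n (1 - x) - (-1) ^ n * beta n x).
assert (Dp : forall n x, is_derive (p (S n)) x (- p n x)).
{ intros m y; unfold p; auto_derive.
  - repeat split; eexists; apply HD.
  - rewrite !(is_derive_unique _ _ _ (HD m _)); simpl; unfold Rminus; ring. }
enough (P : forall n x, p n x = 0).
{ intros n x; specialize (P n x); unfold p in P; lra. }
induction n as [|n IH]; intros x.
{ unfold p; rewrite !H0; simpl; ring. }
assert (Hc : forall a b, a < b -> p (S n) a = p (S n) b).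
{ intros a b Hab.
  destruct (mean_value _ _ a b (Dp n) Hab) as [c [_ E]].
  rewrite IH in E; lra. }
assert (Hx : forall y, p (S n) y = p (S n) x).
{ intros y; destruct (Rtotal_order y x) as [L|[->|L]]; auto.
  symmetry; now apply Hc. }
destruct (mean_value _ _ 0 1 (Dp (S n)) Rlt_0_1) as [c [_ E]].
rewrite Hx in E; unfold p in E at 1 2.
replace (1 - 1) with 0 in E by ring; replace (1 - 0) with 1 in E by ring.
rewrite (Hper (S (S n))) in E by lia; lra.
Qed.

(** For odd degree the reflection changes the sign. The point 1/2 is fixed by it, and the endpoints
    0 and 1 carry equal values from degree 2 on, so degree 1 has to be left out. *)
Lemma appell_odd_zero (beta : nat -> R -> R) :
  (forall x, beta 0%nat x = 1) ->
  (forall n x, is_derive (beta (S n)) x (beta n x)) ->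
  (forall n, (2 <= n)%nat -> beta n 0 = beta n 1) ->
  forall k, beta (2 * k + 3)%nat 0 = 0 /\ beta (2 * k + 3)%nat (1 / 2) = 0.
Proof.
intros H0 HD Hper k.
assert (Hr := appell_reflection beta H0 HD Hper (2 * k + 3)).
assert (Hs : (-1) ^ (2 * k + 3) = -1).
{ replace (2 * k + 3)%nat with (S (2 * (k + 1))) by lia; apply pow_1_odd. }
split.
- specialize (Hr 1); rewrite Hs in Hr; replace (1 - 1) with 0 in Hr by ring.
  rewrite <- Hper in Hr by lia; lra.
- specialize (Hr (1 / 2)); rewrite Hs in Hr.
  replace (1 - 1 / 2) with (1 / 2) in Hr by field; lra.
Qed.

(** A zero of beta_(2k+2) at 0, together with the interior zero that Rolle gives between the zeros 0
    and 1/2 of beta_(2k+3), would produce a zero of beta_(2k+1) in (0, 1/2). *)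
Lemma appell_even_neq_0 (beta : nat -> R -> R) :
  (forall x, beta 0%nat x = 1) -> beta 1%nat 0 = - (1 / 2) ->
  (forall n x, is_derive (beta (S n)) x (beta n x)) ->
  (forall n, (2 <= n)%nat -> beta n 0 = beta n 1) ->
  forall k, beta (2 * k + 2)%nat 0 <> 0.
Proof.
intros H0 H1 HD Hper.
assert (Hodd := appell_odd_zero beta H0 HD Hper).
assert (D2 : forall k x, is_derive (beta (2 * k + 2)%nat) x (beta (2 * k + 1)%nat x)).
{ intros k x; replace (2 * k + 2)%nat with (S (2 * k + 1)) by lia; apply HD. }
assert (D3 : forall k x, is_derive (beta (2 * k + 3)%nat) x (beta (2 * k + 2)%nat x)).
{ intros k x; replace (2 * k + 3)%nat with (S (2 * k + 2)) by lia; apply HD. }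
(* Induction on k, starting from beta_1(x) = x - 1/2. A zero x of beta_(2k+3) inside (0, 1/2) would
   give three zeros 0, x, 1/2, hence two zeros of beta_(2k+2) and one of beta_(2k+1) between
   them. *)
assert (Hnz : forall k x, 0 < x < 1 / 2 -> beta (2 * k + 1)%nat x <> 0).
{ induction k as [|k IH]; intros x Hx E.
  - simpl in E.
    destruct (mean_value _ _ 0 x (HD 0%nat) (proj1 Hx)) as [c [_ Ec]].
    rewrite H0 in Ec; lra.
  - replace (2 * S k + 1)%nat with (2 * k + 3)%nat in E by lia.
    destruct (Hodd k) as [E0 E1].
    destruct (rolle _ _ 0 x (D3 k)) as [a [Ha Ea]]; [lra|lra|].
    destruct (rolle _ _ x (1 / 2) (D3 k)) as [b [Hb Eb]]; [lra|lra|].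
    destruct (rolle _ _ a b (D2 k)) as [c [Hc Ec]]; [lra|lra|].
    apply (IH c); [lra|exact Ec]. }
intros k E.
destruct (Hodd k) as [E0 E1].
destruct (rolle _ _ 0 (1 / 2) (D3 k)) as [a [Ha Ea]]; [lra|lra|].
destruct (rolle _ _ 0 a (D2 k)) as [c [Hc Ec]]; [lra|lra|].
apply (Hnz k c); [lra|exact Ec].
Qed.

(** * Normalised Bernoulli polynomials *)

Definition bernoulli_coef (k : nat) : R := bernoulli k / INR (fact k).

(** This is B_n(x)/n!. Dividing by n! removes the factor n from the derivative, so that the general
    lemmas on [beta] apply. *)
Definition bernoulli_poly (n : nat) (x : R) : R :=
  sum_f_R0 (fun j => bernoulli_coef j * (x ^ (n - j) / INR (fact (n - j)))) n.

(** The Bernoulli recurrence divided by (n+1)!, that is, the coefficient of t^n in t/(e^t - 1) times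
    (e^t - 1)/t. The cancellation in the Euler-Maclaurin step rests on it. *)
Lemma sum_bernoulli_coef (n : nat) :
  sum_f_R0 (fun j => bernoulli_coef j * / INR (fact (S n - j))) n
    = if Nat.eqb n 0 then 1 else 0.
Proof.
destruct n as [|n]; [unfold bernoulli_coef, bernoulli; simpl; field|].
simpl Nat.eqb; cbv iota.
apply Rmult_eq_reg_l with (INR (fact (S n + 1))); [|apply INR_fact_neq_0].
rewrite Rmult_0_r, <- (bernoulli_rec (S n)) by lia.
rewrite scal_sum; apply sum_eq; intros j Hj.
unfold bernoulli_coef, Binomial.C.
replace (S n + 1 - j)%nat with (S (S n) - j)%nat by lia.
field; split; apply INR_fact_neq_0.
Qed.

Lemma is_derive_monomial (m : nat) (x : R) :
  is_derive (fun y => y ^ S m / INR (fact (S m))) x (x ^ m / INR (fact m)).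
Proof.
replace (x ^ m / INR (fact m)) with (/ INR (fact (S m)) * (INR (S m) * 1 * x ^ m)).
2: { rewrite fact_simpl, mult_INR.
     field; split; [apply INR_fact_neq_0|apply not_0_INR; lia]. }
apply is_derive_ext with (fun y => / INR (fact (S m)) * y ^ S m).
{ intros y; apply Rmult_comm. }
apply is_derive_scal, (is_derive_pow (fun y => y) (S m)), @is_derive_id.
Qed.

Lemma is_derive_sum_f_R0 (f f' : nat -> R -> R) (n : nat) (x : R) :
  (forall k, (k <= n)%nat -> is_derive (f k) x (f' k x)) ->
  is_derive (fun y => sum_f_R0 (fun k => f k y) n) x (sum_f_R0 (fun k => f' k x) n).
Proof.
induction n as [|n IH]; intros H; simpl; [now apply H|].
apply @is_derive_plus; [apply IH; intros; apply H; lia|now apply H].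
Qed.

Lemma bernoulli_poly_derive (n : nat) (x : R) :
  is_derive (bernoulli_poly (S n)) x (bernoulli_poly n x).
Proof.
unfold bernoulli_poly.
apply is_derive_ext with (fun y =>
  sum_f_R0 (fun j => bernoulli_coef j * (y ^ S (n - j) / INR (fact (S (n - j))))) n
  + bernoulli_coef (S n)).
{ intros y; rewrite tech5, Nat.sub_diag.
  f_equal; [|simpl; field].
  apply sum_eq; intros j Hj; now rewrite Nat.sub_succ_l. }
rewrite <- (Rplus_0_r (sum_f_R0 _ n)).
apply @is_derive_plus; [|apply @is_derive_const].
apply (is_derive_sum_f_R0
  (fun j y => bernoulli_coef j * (y ^ S (n - j) / INR (fact (S (n - j)))))
  (fun j y => bernoulli_coef j * (y ^ (n - j) / INR (fact (n - j))))).
intros j _; apply is_derive_scal, is_derive_monomial.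
Qed.

Lemma bernoulli_poly_0 (n : nat) : bernoulli_poly n 0 = bernoulli_coef n.
Proof.
unfold bernoulli_poly; destruct n as [|n]; [simpl; field|].
rewrite tech5, Nat.sub_diag, sum_eq_R0; [simpl; field|].
intros j Hj; rewrite Nat.sub_succ_l by lia; rewrite pow_i by lia.
unfold Rdiv; ring.
Qed.

(** At 1 all powers are 1, so the summands before the last add up to [sum_bernoulli_coef] at n - 1
    >= 1, which is 0. The last summand is the value at 0. *)
Lemma bernoulli_poly_periodic (n : nat) : (2 <= n)%nat ->
  bernoulli_poly n 0 = bernoulli_poly n 1.
Proof.
intros Hn; rewrite bernoulli_poly_0; unfold bernoulli_poly.
destruct n as [|n]; [lia|].
rewrite tech5, Nat.sub_diag.
rewrite (sum_eq _ (fun j => bernoulli_coef j * / INR (fact (S n - j)))).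
2: { intros j _; now rewrite pow1; unfold Rdiv; rewrite Rmult_1_l. }
rewrite sum_bernoulli_coef.
destruct n as [|n]; [lia|]; simpl; field.
Qed.

Lemma bernoulli_coef_odd (k : nat) : bernoulli_coef (2 * k + 3) = 0.
Proof.
rewrite <- bernoulli_poly_0.
apply appell_odd_zero.
- intros x; unfold bernoulli_poly, bernoulli_coef, bernoulli; simpl; field.
- apply bernoulli_poly_derive.
- apply bernoulli_poly_periodic.
Qed.

Lemma bernoulli_coef_1 : bernoulli_coef 1 = - (1 / 2).
Proof.
assert (H := bernoulli_rec 1 (le_n 1)).
unfold bernoulli_coef; simpl in H; rewrite bernoulli_0 in H.
unfold Binomial.C in H; simpl in H; simpl; lra.
Qed.

Lemma bernoulli_even_neq_0 (k : nat) : bernoulli (2 * k + 2) <> 0.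
Proof.
intros E.
apply (appell_even_neq_0 bernoulli_poly) with k.
- intros x; unfold bernoulli_poly, bernoulli_coef, bernoulli; simpl; field.
- rewrite bernoulli_poly_0; apply bernoulli_coef_1.
- apply bernoulli_poly_derive.
- apply bernoulli_poly_periodic.
- rewrite bernoulli_poly_0; unfold bernoulli_coef; rewrite E; unfold Rdiv; ring.
Qed.

(** * Euler–Maclaurin summation over a unit interval *)

Lemma increment_bound (f f' : R -> R) (K t : R) : 0 <= t <= 1 ->
  (forall s, 0 <= s <= 1 -> is_derive f s (f' s)) ->
  (forall s, 0 <= s <= 1 -> Rabs (f' s) <= K) -> Rabs (f t - f 0) <= K.
Proof.
intros Ht Df Hb.
assert (HK : 0 <= K) by (apply Rle_trans with (2 := Hb 0 ltac:(lra)); apply Rabs_pos).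
destruct (Req_dec t 0) as [->|Ht0]; [rewrite Rminus_diag, Rabs_R0; exact HK|].
destruct (MVT_cor2 f f' 0 t) as [c [E Hc]]; [lra| |].
{ intros c Hc; apply is_derive_Reals, Df; lra. }
rewrite E, Rabs_mult, (Rabs_pos_eq (t - 0)) by lra.
assert (P := Hb c ltac:(lra)); assert (Q := Rabs_pos (f' c)); nra.
Qed.

(** The derivative of the Taylor remainder of [g 0] is the remainder of one order less for [g 1], so
    induction and the mean value theorem carry K over. The factorial of the usual bound is given
    up. *)
Lemma taylor_bound (n : nat) : forall (g : nat -> R -> R) (K t : R), 0 <= t <= 1 ->
  (forall k s, 0 <= s <= 1 -> is_derive (g k) s (g (S k) s)) ->
  (forall s, 0 <= s <= 1 -> Rabs (g (S n) s) <= K) ->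
  Rabs (g 0%nat t - sum_f_R0 (fun j => g j 0 * (t ^ j / INR (fact j))) n) <= K.
Proof.
induction n as [|n IH]; intros g K t Ht Dg Hb.
{ simpl; replace (g 0%nat 0 * (1 / 1)) with (g 0%nat 0) by field.
  apply increment_bound with (g 1%nat); auto. }
set (h := fun s => g 0%nat s
  - (g 0%nat 0 + sum_f_R0 (fun j => g (S j) 0 * (s ^ S j / INR (fact (S j)))) n)).
set (h' := fun s => g 1%nat s
  - (0 + sum_f_R0 (fun j => g (S j) 0 * (s ^ j / INR (fact j))) n)).
assert (E : forall s,
  g 0%nat s - sum_f_R0 (fun j => g j 0 * (s ^ j / INR (fact j))) (S n) = h s - h 0).
{ intros s; rewrite decomp_sum by lia; unfold h; simpl pred.
  rewrite (sum_eq_R0 (fun j => g (S j) 0 * (0 ^ S j / INR (fact (S j))))).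
  - simpl (fact 0); simpl pow; simpl INR at 1; field.
  - intros j _; rewrite pow_i by lia; unfold Rdiv; ring. }
rewrite E; apply increment_bound with h'; [exact Ht| |].
- intros s Hs; unfold h, h'.
  apply @is_derive_minus; [now apply Dg|].
  apply @is_derive_plus; [apply @is_derive_const|].
  apply (is_derive_sum_f_R0
    (fun j y => g (S j) 0 * (y ^ S j / INR (fact (S j))))
    (fun j y => g (S j) 0 * (y ^ j / INR (fact j)))).
  intros j _; apply is_derive_scal, is_derive_monomial.
- intros s Hs; unfold h'; rewrite Rplus_0_l.
  apply (IH (fun k => g (S k))); auto.
Qed.

(** Summation of the triangle k + j <= n along its diagonals m = k + j. *)
Lemma sum_f_R0_triangle (f : nat -> nat -> R) (n : nat) :
  sum_f_R0 (fun k => sum_f_R0 (fun j => f k j) (n - k)) n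
  = sum_f_R0 (fun m => sum_f_R0 (fun k => f k (m - k)%nat) m) n.
Proof.
induction n as [|n IH]; [reflexivity|].
rewrite tech5, Nat.sub_diag.
rewrite (sum_eq _ (fun k => sum_f_R0 (fun j => f k j) (n - k) + f k (S n - k)%nat)).
2: { intros k Hk; rewrite Nat.sub_succ_l by lia; reflexivity. }
rewrite sum_plus, IH; simpl; rewrite Nat.sub_diag; ring.
Qed.

Lemma euler_maclaurin_step (M : nat) (g : nat -> R -> R) (K : R) :
  (forall k s, 0 <= s <= 1 -> is_derive (g k) s (g (S k) s)) ->
  (forall s, 0 <= s <= 1 -> Rabs (g (M + 2)%nat s) <= K) ->
  Rabs (sum_f_R0 (fun k => bernoulli_coef k * (g k 1 - g k 0)) M - g 1%nat 0)
    <= sum_f_R0 (fun k => Rabs (bernoulli_coef k)) M * K.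
Proof.
intros Dg Hb.
(* Taylor part of g_k(1) - g_k(0). Its length depends on k so that every remainder involves the same
   derivative g_(M+2). *)
set (T := fun k => sum_f_R0 (fun j => / INR (fact (S j)) * g (S (k + j)) 0) (M - k)).
assert (HT : forall k, (k <= M)%nat -> Rabs (g k 1 - g k 0 - T k) <= K).
{ intros k Hk.
  assert (P := taylor_bound (S (M - k)) (fun j => g (k + j)%nat) K 1 ltac:(lra)).
  cbv beta in P; rewrite Nat.add_0_r in P.
  rewrite decomp_sum in P by lia; simpl pred in P; rewrite Nat.add_0_r in P.
  replace (g k 1 - g k 0 - T k) with
    (g k 1 - (g k 0 * (1 ^ 0 / INR (fact 0)) + sum_f_R0 (fun i =>
       g (k + S i)%nat 0 * (1 ^ S i / INR (fact (S i)))) (M - k))).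
  - apply P.
    + intros j s Hs; replace (k + S j)%nat with (S (k + j)) by lia; now apply Dg.
    + intros s Hs; replace (k + S (S (M - k)))%nat with (M + 2)%nat by lia; auto.
  - unfold T; rewrite (sum_eq _ (fun j => / INR (fact (S j)) * g (S (k + j)) 0)).
    + simpl (1 ^ 0); simpl (INR (fact 0)); field.
    + intros j _; rewrite pow1, Nat.add_succ_r; unfold Rdiv; ring. }
(* Collected by order, g_(m+1)(0) has the coefficient computed in [sum_bernoulli_coef], which is 1
   for m = 0 and 0 otherwise. *)
assert (ET : sum_f_R0 (fun k => bernoulli_coef k * T k) M = g 1%nat 0).
{ unfold T.
  rewrite (sum_eq _ (fun k => sum_f_R0 (fun j =>
    bernoulli_coef k * (/ INR (fact (S j)) * g (S (k + j)) 0)) (M - k))).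
  2: { intros k _; rewrite scal_sum; apply sum_eq; intros; ring. }
  rewrite (sum_f_R0_triangle
    (fun k j => bernoulli_coef k * (/ INR (fact (S j)) * g (S (k + j)) 0))).
  rewrite (sum_eq _ (fun m => g (S m) 0 * (if Nat.eqb m 0 then 1 else 0))).
  2: { intros m _; rewrite <- sum_bernoulli_coef, scal_sum.
       apply sum_eq; intros j Hj.
       replace (j + (m - j))%nat with m by lia; rewrite Nat.sub_succ_l by lia; ring. }
  destruct M as [|M]; [simpl; ring|].
  rewrite decomp_sum by lia; rewrite sum_eq_R0; [simpl; ring|].
  intros m _; simpl; ring. }
rewrite <- ET, <- minus_sum.
rewrite (Rmult_comm _ K), scal_sum.
apply Rle_trans with (1 := Rsum_abs _ _).
apply sum_Rle; intros k Hk.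
rewrite <- Rmult_minus_distr_l, Rabs_mult.
apply Rmult_le_compat_l; [apply Rabs_pos|auto].
Qed.


(** * The logarithm along horizontal lines *)

(** The plane cut along the closed negative real axis, where the principal logarithm is smooth. *)
Definition slit (w : C) : Prop := Im w <> 0 \/ 0 < Re w.

Lemma slit_neq_0 (w : C) : slit w -> w <> 0.
Proof. intros [H|H] E; rewrite E in H; simpl in H; lra. Qed.

Lemma slit_sqr (w : C) : slit w -> 0 < Re w * Re w + Im w * Im w.
Proof.
intros [H|H]; [|nra].
assert (0 < Im w * Im w) by now apply Rsqr_pos_lt.
nra.
Qed.

Lemma slit_plus (w : C) (t : R) : slit w -> 0 <= t -> slit (w + t).
Proof. unfold slit; destruct w; simpl; intros [H|H] Ht; [left|right]; lra. Qed.

Lemma sqrt_sub_sqr_div_Cmod (w : C) : w <> 0 ->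
  sqrt (1 - (Re w / Cmod w)²) = Rabs (Im w) / Cmod w.
Proof.
intros Hw; apply Cmod_gt_0 in Hw; assert (E := Cmod2_alt w).
rewrite <- (sqrt_Rsqr (Rabs (Im w) / Cmod w)).
2: { apply Rdiv_le_0_compat; [apply Rabs_pos|exact Hw]. }
f_equal; rewrite !Rsqr_div', <- Rsqr_abs; unfold Rsqr.
field_simplify_eq; [nra|lra].
Qed.

Lemma abs_Carg (w : C) : Rabs (Carg w) = acos (Re w / Cmod w).
Proof.
assert (B := acos_bound (Re w / Cmod w)).
unfold Carg; destruct (Rle_dec 0 (Im w)).
- now apply Rabs_pos_eq.
- now rewrite Rabs_Ropp, Rabs_pos_eq.
Qed.

(** The arctangent form of |arg w| has a derivative in Re w that can be computed directly, also
    where Re w changes sign. *)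
Lemma acos_nonreal (w : C) : Im w <> 0 ->
  acos (Re w / Cmod w) = PI / 2 - atan (Re w / Rabs (Im w)).
Proof.
intros Hi.
assert (Hw : 0 < Cmod w) by (apply Cmod_gt_0, slit_neq_0; now left).
assert (HI : 0 < Rabs (Im w)) by now apply Rabs_pos_lt.
assert (Hu : -1 < Re w / Cmod w < 1).
{ assert (E := Cmod2_alt w); assert (0 < Im w ^ 2) by now apply pow2_gt_0.
  assert (Hlt : Rabs (Re w) < Cmod w).
  { rewrite <- (Rabs_pos_eq (Cmod w)) by lra; apply Rsqr_lt_abs_0; unfold Rsqr; nra. }
  apply Rabs_def2 in Hlt.
  split; [apply Rlt_div_r|apply Rlt_div_l]; lra. }
rewrite acos_asin, asin_atan by lra.
rewrite sqrt_sub_sqr_div_Cmod by (apply slit_neq_0; now left).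
do 2 f_equal; field; lra.
Qed.

(** In the right half plane |arg w| = atan(|Im w| / Re w), and atan u <= u. On the positive axis
    this yields arg w = 0; for z + n it yields an argument of order 1/n. *)
Lemma abs_Carg_le (w : C) : 0 < Re w -> Rabs (Carg w) <= Rabs (Im w) / Re w.
Proof.
intros Hr; rewrite abs_Carg.
assert (Hw : w <> 0) by (apply slit_neq_0; now right).
rewrite acos_atan by (apply Rdiv_lt_0_compat; [exact Hr|now apply Cmod_gt_0]).
rewrite sqrt_sub_sqr_div_Cmod by exact Hw.
apply Cmod_gt_0 in Hw.
replace (Rabs (Im w) / Cmod w / (Re w / Cmod w)) with (Rabs (Im w) / Re w) by (field; lra).
set (u := Rabs (Im w) / Re w).
assert (Hu : 0 <= u) by (apply Rdiv_le_0_compat; [apply Rabs_pos|exact Hr]).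
assert (B := bounded_variation atan (fun t => / (1 + t²)) 1 0 u).
rewrite atan_0, !Rminus_0_r, (Rabs_pos_eq u), Rmult_1_l in B by exact Hu.
apply Rle_trans with (1 := Rle_abs _), B.
intros t _; split; [apply is_derive_atan|].
assert (0 <= t²) by apply Rle_0_sqr.
rewrite Rabs_pos_eq; [|left; apply Rinv_0_lt_compat; lra].
rewrite <- Rinv_1; apply Rinv_le_contravar; lra.
Qed.

(** Derivative along a horizontal line, taken by components so that the real mean value and Taylor
    bounds apply to each of them. *)
Definition is_cderive (f : R -> C) (t : R) (l : C) : Prop :=
  is_derive (fun s => Re (f s)) t (Re l) /\ is_derive (fun s => Im (f s)) t (Im l).

Lemma is_cderive_ext (f g : R -> C) (t : R) (l : C) :
  (forall s, f s = g s) -> is_cderive f t l -> is_cderive g t l.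
Proof.
intros E [Hr Hi]; split;
  [revert Hr|revert Hi]; apply is_derive_ext; intros s; now rewrite E.
Qed.

Lemma is_cderive_const (c : C) (t : R) : is_cderive (fun _ => c) t 0.
Proof. split; apply @is_derive_const. Qed.

Lemma is_cderive_plus (f g : R -> C) (t : R) (a b : C) :
  is_cderive f t a -> is_cderive g t b -> is_cderive (fun s => f s + g s)%C t (a + b).
Proof. intros [Fr Fi] [Gr Gi]; split; now apply @is_derive_plus. Qed.

Lemma is_cderive_mult (f g : R -> C) (t : R) (a b : C) :
  is_cderive f t a -> is_cderive g t b ->
  is_cderive (fun s => f s * g s)%C t (a * g t + f t * b).
Proof.
intros [Fr Fi] [Gr Gi]; split.
- apply is_derive_ext with (fun s => Re (f s) * Re (g s) - Im (f s) * Im (g s)); [reflexivity|].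
  replace (Re _) with ((Re a * Re (g t) + Re (f t) * Re b)
    - (Im a * Im (g t) + Im (f t) * Im b)) by (simpl; unfold Re, Im; ring).
  apply @is_derive_minus; apply @is_derive_mult; try assumption; apply Rmult_comm.
- apply is_derive_ext with (fun s => Re (f s) * Im (g s) + Im (f s) * Re (g s)); [reflexivity|].
  replace (Im _) with ((Re a * Im (g t) + Re (f t) * Im b)
    + (Im a * Re (g t) + Im (f t) * Re b)) by (simpl; unfold Re, Im; ring).
  apply @is_derive_plus; apply @is_derive_mult; try assumption; apply Rmult_comm.
Qed.

Lemma is_cderive_Clog (z : C) (t : R) : slit (z + t) ->
  is_cderive (fun s => Clog (z + s))%C t (/ (z + t)).
Proof.
destruct z as [x y]; intros Hs.
assert (Hsq : 0 < (x + t) * (x + t) + y * y).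
{ apply slit_sqr in Hs; simpl in Hs; now rewrite Rplus_0_r in Hs. }
split.
- apply is_derive_ext with (fun s => ln (sqrt ((x + s) * (x + s) + y * y))).
  { intros s; simpl; unfold Cmod; simpl; do 2 f_equal; ring. }
 
  assert (Hq := sqrt_lt_R0 _ Hsq); assert (Es := sqrt_sqrt _ (Rlt_le _ _ Hsq)).
  auto_derive; [repeat split; assumption|].
  simpl; replace ((x + t) * ((x + t) * 1) + (y + 0) * ((y + 0) * 1))
    with ((x + t) * (x + t) + y * y) by ring.
  rewrite <- Es at 3; field; lra.
(* Off the real axis the argument is an arctangent with a sign. On it, x + t > 0, and the argument
   vanishes in a neighbourhood of t. *)
- destruct (Rtotal_order y 0) as [Hy|[->|Hy]].
  + apply is_derive_ext with (fun s => - (PI / 2 - atan ((x + s) / (- y)))).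
    { intros s; simpl; unfold Carg; simpl.
      destruct (Rle_dec 0 (y + 0)); [lra|].
      change (x + s) with (Re ((x, y) + RtoC s)%C) at 2.
      rewrite acos_nonreal by (simpl; lra); simpl.
      rewrite Rabs_left by lra; do 4 f_equal; ring. }
    auto_derive; [lra|].
    simpl; unfold Rsqr; field; repeat split; nra.
  + assert (Hx : 0 < x + t) by (destruct Hs as [H|H]; simpl in H; lra).
    apply is_derive_ext_loc with (fun _ => 0).
    { exists (mkposreal _ Hx); intros s Hb.
      apply Rabs_def2 in Hb; unfold minus, plus, opp in Hb; simpl in Hb.
      simpl; symmetry; apply Rabs_eq_0, Rle_antisym; [|apply Rabs_pos].
      assert (P := abs_Carg_le ((x, 0) + s)%C); simpl in P.
      rewrite Rplus_0_r, Rabs_R0 in P; unfold Rdiv in P; rewrite Rmult_0_l in P.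
      apply P; lra. }
    simpl; rewrite Rplus_0_r; unfold Rdiv; rewrite Ropp_0, Rmult_0_l.
    apply @is_derive_const.
  + apply is_derive_ext with (fun s => PI / 2 - atan ((x + s) / y)).
    { intros s; simpl; unfold Carg; simpl.
      destruct (Rle_dec 0 (y + 0)); [|lra].
      change (x + s) with (Re ((x, y) + RtoC s)%C) at 2.
      rewrite acos_nonreal by (simpl; lra); simpl.
      rewrite Rabs_pos_eq by lra; do 3 f_equal; ring. }
    auto_derive; [lra|].
    simpl; unfold Rsqr; field; repeat split; nra.
Qed.

Lemma is_cderive_Cinv (z : C) (t : R) : slit (z + t) ->
  is_cderive (fun s => / (z + s))%C t (- (/ (z + t)) ^ 2).
Proof.
destruct z as [x y]; intros Hs.
assert (Hsq : 0 < (x + t) * (x + t) + y * y).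
{ apply slit_sqr in Hs; simpl in Hs; now rewrite Rplus_0_r in Hs. }
split.
- apply is_derive_ext with (fun s => (x + s) / ((x + s) * (x + s) + y * y)).
  { intros s; simpl; do 2 f_equal; ring. }
  auto_derive; [lra|].
  simpl; field; nra.
- apply is_derive_ext with (fun s => - y / ((x + s) * (x + s) + y * y)).
  { intros s; simpl; do 2 f_equal; ring. }
  auto_derive; [lra|].
  simpl; field; nra.
Qed.


Lemma is_cderive_scal (c : C) (f : R -> C) (t : R) (a : C) :
  is_cderive f t a -> is_cderive (fun s => c * f s)%C t (c * a).
Proof.
intros Hf.
replace (c * a)%C with (0 * f t + c * a)%C by ring.
apply is_cderive_mult; [apply is_cderive_const|exact Hf].
Qed.

Lemma is_cderive_Cinv_pow (z : C) (n : nat) (t : R) : slit (z + t) ->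
  is_cderive (fun s => (/ (z + s)) ^ n)%C t (- INR n * (/ (z + t)) ^ S n).
Proof.
intros Hs; induction n as [|n IH].
- replace (- INR 0 * (/ (z + t)) ^ 1)%C with (RtoC 0) by (simpl; ring).
  apply (is_cderive_const 1).
- replace (- INR (S n) * (/ (z + t)) ^ S (S n))%C with
    (- (/ (z + t)) ^ 2 * (/ (z + t)) ^ n + / (z + t) * (- INR n * (/ (z + t)) ^ S n))%C.
  2: { rewrite S_INR, RtoC_plus; simpl; ring. }
  apply is_cderive_mult; [now apply is_cderive_Cinv|exact IH].
Qed.

(** * Derivatives of log^2/2 and their growth *)

Definition harmonic (m : nat) : R := sum_n_m (fun j => 1 / INR j) 1 m.

Lemma harmonic_S (m : nat) : harmonic (S m) = harmonic m + 1 / INR (S m).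
Proof. apply (sum_n_Sm (G := R_AbelianGroup)); lia. Qed.

Lemma harmonic_0 : harmonic 0 = 0.
Proof. apply (sum_n_m_zero (G := R_AbelianGroup)); lia. Qed.

Lemma harmonic_ge_0 (m : nat) : 0 <= harmonic m.
Proof.
induction m as [|m IH]; [rewrite harmonic_0; lra|].
rewrite harmonic_S.
assert (0 < 1 / INR (S m)) by (apply Rdiv_lt_0_compat; [lra|apply lt_0_INR; lia]).
lra.
Qed.

(* The [k]-th derivative of [Clog w ^ 2 / 2]. *)
Definition log_sq_deriv (k : nat) (w : C) : C :=
  match k with
  | 0%nat => (RtoC (1 / 2)%R * Clog w ^ 2)%C
  | S m => (RtoC ((-1) ^ m * INR (fact m))%R * ((Clog w - harmonic m) * (/ w) ^ S m))%C
  end.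

(** With H_m the harmonic numbers, the derivative of (log w - H_m) w^(-m-1) is -(m+1) (log w - H_m -
    1/(m+1)) w^(-m-2), which turns H_m into H_(m+1). *)
Lemma is_cderive_log_sq_deriv (k : nat) (z : C) (t : R) : slit (z + t) ->
  is_cderive (fun s => log_sq_deriv k (z + s)) t (log_sq_deriv (S k) (z + t)).
Proof.
intros Hs; destruct k as [|m]; unfold log_sq_deriv.
- apply is_cderive_ext with
    (fun s => (1 / 2)%R * (Clog (z + s) * Clog (z + s)))%C.
  { intros s; simpl; ring. }
  match goal with |- is_cderive _ _ ?l => replace l with
    ((1 / 2)%R * (/ (z + t) * Clog (z + t) + Clog (z + t) * / (z + t)))%C end.
  + apply is_cderive_scal, is_cderive_mult; now apply is_cderive_Clog.
  + replace ((-1) ^ 0 * INR (fact 0)) with 1 by (simpl; ring).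
    rewrite harmonic_0, Cpow_1_r, RtoC_div by lra; field.
    now apply slit_neq_0.
- match goal with |- is_cderive _ _ ?l => replace l with
    (((-1) ^ m * INR (fact m))%R * ((/ (z + t) + - 0) * (/ (z + t)) ^ S m +
      (Clog (z + t) - harmonic m) * (- INR (S m) * (/ (z + t)) ^ S (S m))))%C end.
  + apply is_cderive_scal, is_cderive_mult; [|now apply is_cderive_Cinv_pow].
    apply is_cderive_plus; [now apply is_cderive_Clog|].
    replace (- 0)%C with (RtoC 0) by ring.
    apply is_cderive_const.
  + rewrite harmonic_S, fact_simpl, mult_INR.
    assert (HS : INR (S m) <> 0) by (apply not_0_INR; lia).
    rewrite RtoC_plus, RtoC_div by exact HS.
    rewrite <- tech_pow_Rmult, !RtoC_mult.
    assert (RtoC (INR (S m)) <> 0) by (intros E; now apply HS, RtoC_inj).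
    assert (z + t <> 0)%C by now apply slit_neq_0.
    rewrite !Cpow_S; set (p := ((/ (z + t)) ^ m)%C); field; auto.
Qed.

Lemma ln_le_minus_1 (x : R) : 0 < x -> ln x <= x - 1.
Proof.
intros Hx; assert (P := exp_ineq1_le (ln x)); rewrite exp_ln in P; lra.
Qed.

Lemma Cmod_le_Re_Im (w : C) : Cmod w <= Rabs (Re w) + Rabs (Im w).
Proof.
assert (Hr := Rabs_pos (Re w)); assert (Hi := Rabs_pos (Im w)).
assert (E := Cmod2_alt w).
rewrite <- (pow2_abs (Re w)), <- (pow2_abs (Im w)) in E.
apply Rsqr_incr_0_var; [unfold Rsqr; nra|lra].
Qed.

Lemma Im_le_Cmod (w : C) : Rabs (Im w) <= Cmod w.
Proof.
apply Rle_trans with (2 := Rmax_Cmod w); apply Rmax_r.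
Qed.

(** The real part is 2 log sqrt|w| <= 2 sqrt|w|, and the argument is at most PI <= 4. A square root
    is weak enough to be absorbed by one power of w. *)
Lemma Cmod_Clog_le (w : C) : 1 <= Cmod w -> Cmod (Clog w) <= 6 * sqrt (Cmod w).
Proof.
intros Hw.
assert (Hq : 1 <= sqrt (Cmod w)) by (rewrite <- sqrt_1; now apply sqrt_le_1_alt).
apply Rle_trans with (1 := Cmod_le_Re_Im _); simpl.
assert (Ha : Rabs (Carg w) <= PI) by (apply Rabs_le, Carg_bound).
assert (HPI := PI_4).
rewrite Rabs_pos_eq by (rewrite <- ln_1; apply ln_le; lra).
assert (Hl : ln (Cmod w) <= 2 * sqrt (Cmod w)).
{ rewrite <- (sqrt_sqrt (Cmod w)) at 1 by lra.
  rewrite ln_mult by lra.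
  assert (P := ln_le_minus_1 (sqrt (Cmod w))); lra. }
lra.
Qed.

Lemma log_sq_deriv_bound (m : nat) : exists K, 0 <= K /\ forall w, 1 <= Cmod w ->
  Cmod (log_sq_deriv (S m) w) <= K * (sqrt (Cmod w) / Cmod w ^ S m).
Proof.
exists (INR (fact m) * (6 + harmonic m)).
assert (HF : 0 <= INR (fact m)) by apply pos_INR.
assert (HH := harmonic_ge_0 m).
split; [apply Rmult_le_pos; lra|].
intros w Hw; unfold log_sq_deriv.
assert (Hw0 : w <> 0) by (apply Cmod_gt_0; lra).
assert (Hq : 1 <= sqrt (Cmod w)) by (rewrite <- sqrt_1; now apply sqrt_le_1_alt).
rewrite !Cmod_mult, Cmod_pow, Cmod_inv, pow_inv, Cmod_R, Rabs_mult by exact Hw0.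
rewrite pow_1_abs, Rmult_1_l, (Rabs_pos_eq (INR _)) by exact HF.
unfold Rdiv; rewrite !Rmult_assoc; apply Rmult_le_compat_l; [exact HF|].
rewrite <- Rmult_assoc; apply Rmult_le_compat_r.
{ left; apply Rinv_0_lt_compat, pow_lt; lra. }
apply Rle_trans with (1 := Cmod_triangle _ _).
rewrite Cmod_opp, Cmod_R, (Rabs_pos_eq (harmonic m)) by exact HH.
assert (P := Cmod_Clog_le w Hw); nra.
Qed.

(** Estimating sqrt|w| by |w| costs one power of w but leaves an integer exponent. The number rho is
    a common lower bound for |w| along a unit segment. *)
Lemma log_sq_deriv_pow_bound (m : nat) : exists K, 0 <= K /\
  forall (w : C) (rho : R), 1 <= rho -> rho <= Cmod w ->
  Cmod (log_sq_deriv (S m) w) <= K / rho ^ m.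
Proof.
destruct (log_sq_deriv_bound m) as [K [HK B]].
exists K; split; [exact HK|]; intros w rho Hr Hw.
apply Rle_trans with (1 := B w ltac:(lra)).
unfold Rdiv; apply Rmult_le_compat_l; [exact HK|].
assert (P0 : 0 < Cmod w ^ m) by (apply pow_lt; lra).
apply Rle_trans with (/ Cmod w ^ m).
- rewrite <- tech_pow_Rmult, Rinv_mult, <- Rmult_assoc.
  rewrite <- (Rmult_1_l (/ Cmod w ^ m)) at 2.
  apply Rmult_le_compat_r; [left; now apply Rinv_0_lt_compat|].
  apply Rle_div_l; [lra|]; rewrite Rmult_1_l.
  assert (Hq : 1 <= sqrt (Cmod w)) by (rewrite <- sqrt_1; apply sqrt_le_1_alt; lra).
  assert (E := sqrt_sqrt (Cmod w)); nra.
- apply Rinv_le_contravar; [apply pow_lt; lra|apply pow_incr; lra].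
Qed.

Lemma Re_sum_n (a : nat -> C) (n : nat) :
  Re (sum_n a n) = sum_f_R0 (fun k => Re (a k)) n.
Proof.
induction n as [|n IH]; [now rewrite sum_O|].
rewrite sum_Sn; simpl; now rewrite <- IH.
Qed.

Lemma Im_sum_n (a : nat -> C) (n : nat) :
  Im (sum_n a n) = sum_f_R0 (fun k => Im (a k)) n.
Proof.
induction n as [|n IH]; [now rewrite sum_O|].
rewrite sum_Sn; simpl; now rewrite <- IH.
Qed.

(** * The Euler-Maclaurin sum and its defect *)

Definition em_sum (M : nat) (w : C) : C :=
  sum_n (fun k => RtoC (bernoulli_coef k) * log_sq_deriv k w)%C M.

Lemma Re_em_sum (M : nat) (w : C) : Re (em_sum M w) =
  sum_f_R0 (fun k => bernoulli_coef k * Re (log_sq_deriv k w)) M.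
Proof.
unfold em_sum; rewrite Re_sum_n; apply sum_eq; intros k _.
unfold Re; simpl; ring.
Qed.

Lemma Im_em_sum (M : nat) (w : C) : Im (em_sum M w) =
  sum_f_R0 (fun k => bernoulli_coef k * Im (log_sq_deriv k w)) M.
Proof.
unfold em_sum; rewrite Im_sum_n; apply sum_eq; intros k _.
unfold Im; simpl; ring.
Qed.

Definition em_defect (M : nat) (w : C) : C :=
  (em_sum M (w + 1) - em_sum M w - Clog w / w)%C.

(** [euler_maclaurin_step] is applied to the real and imaginary parts on the segment from w to w +
    1. The derivative of order M + 2 is O(rho^(-M-1)) there. *)
Lemma em_defect_bound (M : nat) : exists K, 0 <= K /\
  forall (w : C) (rho : R), 1 <= rho ->
  (forall s, 0 <= s <= 1 -> slit (w + s) /\ rho <= Cmod (w + s)) ->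
  Cmod (em_defect M w) <= K / rho ^ S M.
Proof.
destruct (log_sq_deriv_pow_bound (S M)) as [K [HK B]].
set (S0 := sum_f_R0 (fun k => Rabs (bernoulli_coef k)) M).
assert (HS : 0 <= S0) by (apply cond_pos_sum; intros; apply Rabs_pos).
exists (2 * (S0 * K)); split; [nra|]; intros w rho Hr Hw.
assert (HB : forall s, 0 <= s <= 1 -> Cmod (log_sq_deriv (M + 2) (w + s)) <= K / rho ^ S M).
{ intros s Hs; replace (M + 2)%nat with (S (S M)) by lia; apply B; [exact Hr|now apply Hw]. }
assert (HD : forall k s, 0 <= s <= 1 ->
  is_cderive (fun s => log_sq_deriv k (w + s)) s (log_sq_deriv (S k) (w + s))).
{ intros k s Hs; apply is_cderive_log_sq_deriv; now apply Hw. }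
assert (E1 : (Clog w / w)%C = log_sq_deriv 1 (w + 0)).
{ unfold log_sq_deriv; rewrite harmonic_0, Cplus_0_r; simpl; unfold Cdiv.
  rewrite Rmult_1_r; ring. }
assert (E0 : em_sum M w = em_sum M (w + 0)) by now rewrite Cplus_0_r.
unfold em_defect; rewrite E0, E1.
apply Rle_trans with (1 := Cmod_le_Re_Im _).
assert (HR := euler_maclaurin_step M (fun k s => Re (log_sq_deriv k (w + s)))
  (K / rho ^ S M) (fun k s Hs => proj1 (HD k s Hs))
  (fun s Hs => Rle_trans _ _ _ (re_le_Cmod _) (HB s Hs))).
assert (HI := euler_maclaurin_step M (fun k s => Im (log_sq_deriv k (w + s)))
  (K / rho ^ S M) (fun k s Hs => proj2 (HD k s Hs))
  (fun s Hs => Rle_trans _ _ _ (Im_le_Cmod _) (HB s Hs))).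
cbv beta in HR, HI; fold S0 in HR, HI.
replace (2 * (S0 * K) / rho ^ S M) with
  (S0 * (K / rho ^ S M) + S0 * (K / rho ^ S M)) by (unfold Rdiv; ring).
assert (ER : Re (em_sum M (w + 1) - em_sum M (w + 0) - log_sq_deriv 1 (w + 0))%C =
  Re (em_sum M (w + 1)) - Re (em_sum M (w + 0)) - Re (log_sq_deriv 1 (w + 0)))
  by reflexivity.
assert (EI : Im (em_sum M (w + 1) - em_sum M (w + 0) - log_sq_deriv 1 (w + 0))%C =
  Im (em_sum M (w + 1)) - Im (em_sum M (w + 0)) - Im (log_sq_deriv 1 (w + 0)))
  by reflexivity.
rewrite ER, EI, !Re_em_sum, !Im_em_sum, <- !minus_sum.
rewrite (sum_eq _ _ M (fun k _ => Rmult_minus_distr_l _ _ _)) in HR.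
rewrite (sum_eq _ _ M (fun k _ => Rmult_minus_distr_l _ _ _)) in HI.
now apply Rplus_le_compat.
Qed.


(** * Summation of the local defects *)

Definition is_clim (u : nat -> C) (l : C) : Prop :=
  is_lim_seq (fun n => Re (u n)) (Re l) /\ is_lim_seq (fun n => Im (u n)) (Im l).

Lemma is_clim_ext (u v : nat -> C) (l : C) :
  (forall n, u n = v n) -> is_clim u l -> is_clim v l.
Proof.
intros E [Hr Hi]; split; [revert Hr|revert Hi]; apply is_lim_seq_ext; intros n; now rewrite E.
Qed.

Lemma is_clim_const (c : C) : is_clim (fun _ => c) c.
Proof. split; apply is_lim_seq_const. Qed.

Lemma is_clim_plus (u v : nat -> C) (a b : C) :
  is_clim u a -> is_clim v b -> is_clim (fun n => u n + v n)%C (a + b).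
Proof. intros [Ur Ui] [Vr Vi]; split; now apply is_lim_seq_plus'. Qed.

Lemma is_clim_minus (u v : nat -> C) (a b : C) :
  is_clim u a -> is_clim v b -> is_clim (fun n => u n - v n)%C (a - b).
Proof. intros [Ur Ui] [Vr Vi]; split; now apply is_lim_seq_minus'. Qed.

Lemma is_clim_succ (u : nat -> C) (l : C) : is_clim u l -> is_clim (fun n => u (S n)) l.
Proof.
intros [Hr Hi]; split;
  [apply (is_lim_seq_incr_1 (fun n => Re (u n)))|apply (is_lim_seq_incr_1 (fun n => Im (u n)))];
  assumption.
Qed.

(** The rate 1/sqrt(n+1) is what remains of log(n)/n after the logarithm is bounded by a square
    root. *)
Lemma is_clim_0_bound (u : nat -> C) (K : R) (N : nat) :
  (forall n, (N <= n)%nat -> Cmod (u n) <= K / sqrt (INR n + 1)) -> is_clim u 0.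
Proof.
intros HB.
assert (H0 : is_lim_seq (fun n => K / sqrt (INR n + 1)) 0).
{ replace (Finite 0) with (Rbar_mult K 0) by (simpl; f_equal; ring).
  apply is_lim_seq_scal_l.
  apply (is_lim_seq_inv (fun n => sqrt (INR n + 1)) p_infty); [|discriminate].
  apply (filterlim_comp nat R R (fun n => INR n + 1) sqrt eventually
    (Rbar_locally p_infty)); [|exact filterlim_sqrt_p].
  apply is_lim_seq_ext with (fun n => INR (S n)); [intros n; apply S_INR|].
  apply (is_lim_seq_incr_1 INR), is_lim_seq_INR. }
split; apply is_lim_seq_abs_0.
- apply is_lim_seq_le_le_loc with (fun _ => 0) (fun n => K / sqrt (INR n + 1));
    [|apply is_lim_seq_const|exact H0].
  exists N; intros n Hn; split; [apply Rabs_pos|].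
  apply Rle_trans with (1 := re_le_Cmod _); auto.
- apply is_lim_seq_le_le_loc with (fun _ => 0) (fun n => K / sqrt (INR n + 1));
    [|apply is_lim_seq_const|exact H0].
  exists N; intros n Hn; split; [apply Rabs_pos|].
  apply Rle_trans with (1 := Im_le_Cmod _); auto.
Qed.

Lemma shift_lower_bound (z : C) : exists N, forall n, (N <= n)%nat ->
  (INR n + 1) / 2 <= Re (z + INR n) /\ (INR n + 1) / 2 <= Cmod (z + INR n).
Proof.
(* For n >= 2|z| + 1, Re z + n >= n - |z| >= (n+1)/2. *)
destruct (nfloor_ex (2 * Cmod z + 1)) as [N [_ HN]].
{ assert (P := Cmod_ge_0 z); lra. }
exists (S N); intros n Hn; apply le_INR in Hn; rewrite S_INR in Hn.
assert (P := re_le_Cmod z); apply Rabs_le_between in P.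
assert (Q : (INR n + 1) / 2 <= Re (z + INR n)) by (simpl; fold (Re z); lra).
split; [exact Q|].
apply Rle_trans with (2 := re_le_Cmod _).
apply Rle_trans with (1 := Q), Rle_abs.
Qed.

(** The moduli |z + n| and n + 1 differ by at most q = |z| + 1, so log x <= x - 1 for both quotients
    bounds the real part, and [abs_Carg_le] bounds the argument. *)
Lemma Clog_shift_bound (z : C) : exists K N, 0 <= K /\ forall n, (N <= n)%nat ->
  Cmod (Clog (z + INR n) - ln (INR n + 1)) <= K / (INR n + 1).
Proof.
destruct (shift_lower_bound z) as [N HN].
set (q := Cmod z + 1).
assert (Hq : 1 <= q) by (assert (P := Cmod_ge_0 z); unfold q; lra).
exists (4 * q), N; split; [lra|]; intros n Hn.
destruct (HN n Hn) as [H1 H2]; assert (Hn0 := pos_INR n).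
set (b := INR n + 1) in *; set (a := Cmod (z + INR n)) in *.
assert (Hb : 1 <= b) by (unfold b; lra).
assert (Hab : Rabs (a - b) <= q).
{ assert (E1 : a <= b + q).
  { unfold a, b, q; apply Rle_trans with (1 := Cmod_triangle _ _).
    rewrite Cmod_R, Rabs_pos_eq; lra. }
  assert (E2 : b <= a + q).
  { assert (P := Cmod_triangle (z + INR n) (- z)).
    replace (z + INR n + - z)%C with (RtoC (INR n)) in P by ring.
    rewrite Cmod_R, Rabs_pos_eq, Cmod_opp in P by lra.
    unfold a, b, q; lra. }
  apply Rabs_le; lra. }
apply Rabs_le_between in Hab.
assert (Hqb : q / b * b = q) by (field; lra).
assert (Hqb0 : 0 <= q / b) by (apply Rdiv_le_0_compat; lra).
apply Rle_trans with (1 := Cmod_le_Re_Im _).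
replace (4 * q / b) with (2 * (q / b) + 2 * (q / b)) by (field; lra).
apply Rplus_le_compat.
- change (Re (Clog (z + INR n) - ln b)) with (ln a - ln b).
  apply Rabs_le; split.
  + assert (P := ln_le_minus_1 (b / a) ltac:(apply Rdiv_lt_0_compat; lra)).
    rewrite ln_div in P by lra.
    assert (b / a - 1 <= 2 * (q / b)); [|lra].
    apply Rle_trans with (q / a).
    * apply Rmult_le_reg_r with a; [lra|].
      replace ((b / a - 1) * a) with (b - a) by (field; lra).
      replace (q / a * a) with q by (field; lra); lra.
    * apply Rmult_le_reg_r with a; [lra|].
      replace (q / a * a) with q by (field; lra); nra.
  + assert (P := ln_le_minus_1 (a / b) ltac:(apply Rdiv_lt_0_compat; lra)).
    rewrite ln_div in P by lra.
    assert (a / b - 1 <= q / b); [|lra].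
    apply Rmult_le_reg_r with b; [lra|].
    replace ((a / b - 1) * b) with (a - b) by (field; lra); lra.
- change (Im (Clog (z + INR n) - ln b)) with (Carg (z + INR n) - 0).
  rewrite Rminus_0_r.
  apply Rle_trans with (1 := abs_Carg_le (z + INR n)%C ltac:(lra)).
  assert (P : Rabs (Im (z + INR n)) <= q).
  { change (Im (z + INR n)) with (Im z + 0); rewrite Rplus_0_r.
    assert (P := Im_le_Cmod z); unfold q; lra. }
  apply Rle_div_l; [lra|]; nra.
Qed.

(** Only the summand k = 0, log^2(z+n)/2, grows; the derivatives of positive order tend to 0. The
    limit does not depend on z, so sums starting at z and at 1 can be compared. *)
Lemma em_sum_asymp (M : nat) (z : C) :
  is_clim (fun n => em_sum M (z + INR n) - (1 / 2 * ln (INR n + 1) ^ 2)%R)%C 0.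
Proof.
induction M as [|M IH].
- destruct (Clog_shift_bound z) as [K [N [HK HB]]].
  apply is_clim_0_bound with (1 / 2 * (K * (K + 4))) N; intros n Hn.
  specialize (HB n Hn); assert (Hn0 := pos_INR n).
  set (b := INR n + 1) in *; set (eps := (Clog (z + INR n) - ln b)%C) in HB.
  assert (Hb : 1 <= b) by (unfold b; lra).
  assert (Hs : 1 <= sqrt b) by (rewrite <- sqrt_1; now apply sqrt_le_1_alt).
  assert (Es := sqrt_sqrt b ltac:(lra)).
  unfold em_sum; rewrite sum_O; unfold bernoulli_coef, log_sq_deriv.
  (* Difference of squares: with log(z+n) = log b + eps it is eps (eps + 2 log b)/2, where eps =
     O(1/b) and log b = O(sqrt b). *)
  replace (RtoC (bernoulli 0 / INR (fact 0)) * (RtoC (1 / 2)%R * Clog (z + INR n) ^ 2)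
    - (1 / 2 * ln b ^ 2)%R)%C with ((1 / 2)%R * (eps * (eps + (2 * ln b)%R)))%C.
  2: { replace (bernoulli 0 / INR (fact 0)) with 1 by (unfold bernoulli; simpl; field).
       unfold eps; rewrite !RtoC_mult, RtoC_pow; simpl; ring. }
  rewrite !Cmod_mult, Cmod_R, (Rabs_pos_eq (1 / 2)) by lra.
  unfold Rdiv at 2; rewrite (Rmult_assoc (1 / 2)).
  apply Rmult_le_compat_l; [lra|].
  assert (HL : 0 <= ln b <= 2 * sqrt b).
  { split; [rewrite <- ln_1; apply ln_le; lra|].
    rewrite <- Es at 1; rewrite ln_mult by lra.
    assert (P := ln_le_minus_1 (sqrt b)); lra. }
  apply Rle_trans with (K / b * (K + 4 * sqrt b)).
  + apply Rmult_le_compat; try apply Cmod_ge_0; [exact HB|].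
    apply Rle_trans with (1 := Cmod_triangle _ _).
    rewrite Cmod_R, Rabs_pos_eq by lra.
    apply Rplus_le_compat; [|lra].
    apply Rle_trans with (1 := HB); apply Rle_div_l; nra.
  + apply Rmult_le_reg_r with (b * sqrt b); [nra|].
    replace (K / b * (K + 4 * sqrt b) * (b * sqrt b)) with
      (K * (K + 4 * sqrt b) * sqrt b) by (field; lra).
    replace (K * (K + 4) * / sqrt b * (b * sqrt b)) with (K * (K + 4) * b) by (field; lra).
    rewrite <- Es at 3.
    assert (0 <= K * K * sqrt b * (sqrt b - 1)) by (repeat apply Rmult_le_pos; lra).
    nra.
- apply is_clim_ext with (fun n =>
    (em_sum M (z + INR n) - (1 / 2 * ln (INR n + 1) ^ 2)%R)
    + RtoC (bernoulli_coef (S M)) * log_sq_deriv (S M) (z + INR n))%C.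
  { intros n; unfold em_sum; rewrite sum_Sn.
    change (@plus _ ?a ?b) with (Cplus a b); ring. }
  replace (RtoC 0) with (0 + 0)%C by ring.
  apply is_clim_plus; [exact IH|].
  destruct (log_sq_deriv_bound M) as [K [HK HB]].
  destruct (shift_lower_bound z) as [N HN].
  (* Starting at N + 1 forces n >= 1, hence |z + n| >= 1 as the derivative bound requires. The
     factor 2 comes from sqrt b <= 2 sqrt|z + n|. *)
  apply is_clim_0_bound with (Rabs (bernoulli_coef (S M)) * (K * 2)) (S N).
  intros n Hn; destruct (HN n ltac:(lia)) as [_ Hr].
  assert (Hn1 : 1 <= INR n) by (apply (le_INR 1); lia).
  set (b := INR n + 1) in *; set (w := (z + INR n)%C) in *.
  assert (Hb : 2 <= b) by (unfold b; lra).
  rewrite Cmod_mult, Cmod_R; unfold Rdiv; rewrite Rmult_assoc.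
  apply Rmult_le_compat_l; [apply Rabs_pos|].
  apply Rle_trans with (1 := HB w ltac:(lra)).
  rewrite Rmult_assoc; apply Rmult_le_compat_l; [exact HK|].
  assert (Hs : 1 <= sqrt (Cmod w)) by (rewrite <- sqrt_1; apply sqrt_le_1_alt; lra).
  assert (Es := sqrt_sqrt (Cmod w) ltac:(lra)).
  apply Rle_trans with (/ sqrt (Cmod w)).
  + assert (HP : 1 <= Cmod w ^ M) by (apply pow_R1_Rle; lra).
    rewrite <- tech_pow_Rmult; rewrite <- Es at 2.
    apply Rle_div_l; [apply Rmult_lt_0_compat; nra|].
    replace (/ sqrt (Cmod w) * (sqrt (Cmod w) * sqrt (Cmod w) * Cmod w ^ M))
      with (sqrt (Cmod w) * Cmod w ^ M) by (field; lra).
    nra.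
  + assert (Hsb : 0 < sqrt b) by (apply sqrt_lt_R0; lra).
    assert (sqrt b <= 2 * sqrt (Cmod w)).
    { assert (Eb := sqrt_sqrt b ltac:(lra)).
      apply Rsqr_incr_0_var; [unfold Rsqr; nra|lra]. }
    apply Rmult_le_reg_r with (sqrt b * sqrt (Cmod w)); [nra|].
    replace (/ sqrt (Cmod w) * (sqrt b * sqrt (Cmod w))) with (sqrt b) by (field; lra).
    replace (2 * / sqrt b * (sqrt b * sqrt (Cmod w))) with (2 * sqrt (Cmod w)) by (field; lra).
    assumption.
Qed.


Lemma is_series_lim_seq (a : nat -> R) (l : R) :
  is_series a l <-> is_lim_seq (sum_f_R0 a) l.
Proof.
split; intros H.
- apply is_lim_seq_ext with (sum_n a); [intros n; apply sum_n_Reals|exact H].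
- apply (is_lim_seq_ext (sum_f_R0 a) (sum_n a) l); [|exact H].
  intros n; symmetry; apply sum_n_Reals.
Qed.

Lemma is_series_telescoping_inv (r : R) : 1 <= r ->
  is_series (fun j => / (r + INR j) - / (r + INR (S j))) (/ r).
Proof.
intros Hr.
apply is_series_lim_seq.
apply is_lim_seq_ext with (fun n => / r - / (r + INR (S n))).
{ induction n as [|n IH]; [simpl; now rewrite Rplus_0_r|].
  rewrite tech5, <- IH; ring. }
rewrite <- (Rminus_0_r (/ r)) at 1.
apply is_lim_seq_minus'; [apply is_lim_seq_const|].
apply (is_lim_seq_inv (fun n => r + INR (S n)) p_infty); [|discriminate].
apply (is_lim_seq_plus (fun _ => r) (fun n => INR (S n)) r p_infty p_infty);
  [apply is_lim_seq_const| |reflexivity].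
apply (is_lim_seq_incr_1 INR), is_lim_seq_INR.
Qed.

(** Of the p + 2 powers, p are bounded by r, and the other two give 1/x^2 <= 2/(x(x+1)), which
    telescopes in steps of 1. *)
Lemma pow_inv_le_telescope (p : nat) (r x : R) : 1 <= r -> r <= x ->
  / x ^ S (S p) <= 2 / r ^ p * (/ x - / (x + 1)).
Proof.
intros Hr Hx.
assert (Hp : r ^ p <= x ^ p) by (apply pow_incr; lra).
assert (Hp0 : 0 < r ^ p) by (apply pow_lt; lra).
replace (2 / r ^ p * (/ x - / (x + 1))) with (/ (r ^ p * (x * (x + 1) / 2)))
  by (field; lra).
apply Rinv_le_contravar; [apply Rmult_lt_0_compat; nra|].
replace (x ^ S (S p)) with (x ^ p * (x * x)) by (simpl; ring).
apply Rmult_le_compat; nra.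
Qed.

(** What the sum of the defects requires of z: the ray to the right of z avoids the cut, and the
    modulus along it grows at least linearly. *)
Definition far_from_cut (c : R) (z : C) : Prop :=
  forall t, 0 <= t -> slit (z + t) /\ c * (Cmod z + t) <= Cmod (z + t).

Lemma Rseries_bound (a b : nat -> R) (l : R) :
  (forall n, Rabs (a n) <= b n) -> is_series b l ->
  exists s, is_series a s /\ Rabs s <= l.
Proof.
intros Hab Hb.
assert (Hb' : ex_series b) by now exists l.
assert (Ha : ex_series (fun n => Rabs (a n))).
{ apply (ex_series_le (fun n => Rabs (a n)) b); [|exact Hb'].
  intros n; apply Rle_trans with (2 := Hab n); apply Req_le, Rabs_Rabsolu. }
exists (Series a); split; [now apply Series_correct, ex_series_Rabs|].
apply Rle_trans with (1 := Series_Rabs _ Ha).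
rewrite <- (is_series_unique _ _ Hb).
apply Series_le; [|exact Hb'].
intros n; split; [apply Rabs_pos|apply Hab].
Qed.

Lemma em_defect_series (M : nat) (c : R) : (1 <= M)%nat -> 0 < c ->
  exists K, forall z, 1 <= Cmod z -> 1 <= c * Cmod z -> far_from_cut c z ->
  exists E, is_clim (sum_n (fun j => em_defect M (z + INR j))) E /\
    Cmod E <= K / Cmod z ^ M.
Proof.
intros HM Hc; destruct M as [|p]; [lia|].
destruct (em_defect_bound (S p)) as [K [HK HB]].
set (K1 := K / c ^ S (S p)).
assert (HK1 : 0 <= K1) by (apply Rdiv_le_0_compat; [exact HK|now apply pow_lt]).
(* The inner 2 comes from the telescoping bound, the outer one from adding real and imaginary
   parts. *)
exists (2 * (K1 * 2)); intros z Hz Hcz Hfar.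
set (r := Cmod z) in *.
assert (Hd : forall j, Cmod (em_defect (S p) (z + INR j)) <=
  K1 * (2 / r ^ p) * (/ (r + INR j) - / (r + INR (S j)))).
{ intros j; assert (Hj := pos_INR j).
  apply Rle_trans with (K / (c * (r + INR j)) ^ S (S p)).
  - assert (Hcj : 0 <= c * INR j) by (apply Rmult_le_pos; lra).
    apply HB; [lra|].
    intros s Hs; destruct (Hfar (INR j + s)) as [F1 F2]; [lra|].
    rewrite RtoC_plus, Cplus_assoc in F1, F2; split; [exact F1|].
    apply Rle_trans with (2 := F2), Rmult_le_compat_l; unfold r; lra.
  - rewrite Rpow_mult_distr; unfold Rdiv at 1; rewrite Rinv_mult, <- Rmult_assoc.
    fold (K / c ^ S (S p)); fold K1; rewrite Rmult_assoc.
    apply Rmult_le_compat_l; [exact HK1|].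
    rewrite S_INR, <- Rplus_assoc; apply pow_inv_le_telescope; lra. }
assert (Hs := is_series_scal (K1 * (2 / r ^ p)) _ _ (is_series_telescoping_inv r Hz)).
destruct (Rseries_bound (fun j => Re (em_defect (S p) (z + INR j))) _ _
  (fun j => Rle_trans _ _ _ (re_le_Cmod _) (Hd j)) Hs) as [x [Hx Bx]].
destruct (Rseries_bound (fun j => Im (em_defect (S p) (z + INR j))) _ _
  (fun j => Rle_trans _ _ _ (Im_le_Cmod _) (Hd j)) Hs) as [y [Hy By]].
exists (x, y); split.
- split.
  + apply is_series_lim_seq in Hx; revert Hx; apply is_lim_seq_ext.
    intros n; symmetry; apply Re_sum_n.
  + apply is_series_lim_seq in Hy; revert Hy; apply is_lim_seq_ext.
    intros n; symmetry; apply Im_sum_n.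
- apply Rle_trans with (1 := Cmod_le_Re_Im _).
  assert (E : 2 * (K1 * 2) / r ^ S p = 2 * (K1 * (2 / r ^ p) * / r)).
  { simpl; field; split; [|apply pow_nonzero]; lra. }
  rewrite E; simpl; unfold scal in Bx, By; simpl in Bx, By; unfold mult in Bx, By;
    simpl in Bx, By; lra.
Qed.

(** * Exact formulas for gamma_1 and psi_1 by telescoping *)

Lemma Csum_O (a : nat -> C) : sum_n a 0 = a 0%nat :> C.
Proof. exact (sum_O a). Qed.

Lemma Csum_Sn (a : nat -> C) (n : nat) : sum_n a (S n) = (sum_n a n + a (S n))%C :> C.
Proof. exact (sum_Sn a n). Qed.

Lemma em_telescope (M : nat) (z : C) (n : nat) :
  sum_n (fun j => Clog (z + INR j) / (z + INR j))%C n =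
  (em_sum M (z + INR (S n)) - em_sum M z
    - sum_n (fun j => em_defect M (z + INR j)) n)%C :> C.
Proof.
assert (HS : forall k, (z + INR (S k) = z + INR k + 1)%C).
{ intros k; rewrite S_INR, RtoC_plus; ring. }
induction n as [|n IH].
- rewrite !Csum_O, HS; unfold em_defect; simpl INR; rewrite Cplus_0_r; ring.
- rewrite !Csum_Sn, IH.
  unfold em_defect at 3; rewrite (HS (S n)); ring.
Qed.

Lemma Clog_pos (x : R) : 0 < x -> Clog x = RtoC (ln x).
Proof.
intros Hx; unfold Clog; rewrite Cmod_R, Rabs_pos_eq by lra.
unfold RtoC; f_equal.
apply Rabs_eq_0, Rle_antisym; [|apply Rabs_pos].
apply Rle_trans with (1 := abs_Carg_le x Hx); simpl.
rewrite Rabs_R0; unfold Rdiv; lra.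
Qed.

Lemma far_from_cut_1 : far_from_cut 1 1.
Proof.
intros t Ht; split; [right; simpl; lra|].
rewrite <- RtoC_plus, !Cmod_R, !Rabs_pos_eq; lra.
Qed.

Lemma gamma1_em (M : nat) (E : C) :
  is_clim (sum_n (fun j => em_defect M (1 + INR j))) E ->
  RtoC gamma1 = (- (em_sum M 1 + E))%C.
Proof.
intros HE.
set (g := fun n => sum_n_m (fun j => ln (INR j) / INR j) 1 n - ln (INR n) ^ 2 / 2).
assert (Hg : is_clim (fun n => RtoC (g (S n))) (- (em_sum M 1 + E))).
(* The sum from 1 to n + 1 telescopes up to the point n + 2, so [em_sum_asymp] is used with z =
   2. *)
{ apply is_clim_ext with (fun n =>
    (em_sum M (RtoC 2 + INR n) - (1 / 2 * ln (INR n + 1) ^ 2)%R)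
    - (em_sum M 1 + sum_n (fun j => em_defect M (1 + INR j)) n))%C.
  - intros n.
    replace (RtoC (g (S n))) with
      (sum_n (fun j => Clog (1 + INR j) / (1 + INR j))%C n
        - (1 / 2 * ln (INR n + 1) ^ 2)%R)%C.
    + rewrite (em_telescope M).
      replace (RtoC 2 + INR n)%C with (1 + INR (S n))%C; [ring|].
      rewrite S_INR, RtoC_plus; replace (RtoC 2) with (1 + 1)%C; [ring|].
      rewrite <- RtoC_plus; f_equal; ring.
    + unfold g; rewrite S_INR, RtoC_minus; f_equal; [|f_equal; field].
      rewrite <- sum_n_m_S; induction n as [|n IH].
      * unfold sum_n; rewrite !sum_n_n; rewrite <- RtoC_plus.
        rewrite Clog_pos, RtoC_div by (simpl; lra).
        simpl INR; now rewrite Rplus_0_r.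
      * unfold sum_n in *; rewrite !sum_n_Sm by lia; rewrite IH.
        assert (Hp := pos_INR (S n)).
        rewrite <- RtoC_plus, Clog_pos, <- RtoC_div by lra.
        rewrite (S_INR (S n)), (Rplus_comm 1); symmetry; apply RtoC_plus.
  - replace (- (em_sum M 1 + E))%C with (0 - (em_sum M 1 + E))%C by ring.
    apply is_clim_minus; [apply em_sum_asymp|].
    apply is_clim_plus; [apply is_clim_const|exact HE]. }
destruct Hg as [Hr Hi].
unfold gamma1; fold g.
apply (is_lim_seq_incr_1 g) in Hr; rewrite (is_lim_seq_unique _ _ Hr).
rewrite (surjective_pairing (- (em_sum M 1 + E))%C); unfold RtoC; f_equal.
(* The right-hand side is real, being a limit of real numbers. *)
assert (E0 := is_lim_seq_unique _ _ Hi); simpl in E0.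
rewrite Lim_seq_const in E0; now injection E0.
Qed.

(** The series in [psi1] is a sum along z + j without its term j = 0, minus a sum along 1 + j. After
    telescoping, the contributions of the base point 1 cancel against gamma_1. *)
Lemma psi1_em (M : nat) (z E : C) : (1 <= M)%nat ->
  is_clim (sum_n (fun j => em_defect M (z + INR j))) E ->
  psi1 z = (em_sum M z + E)%C.
Proof.
intros HM HE.
destruct (em_defect_series M 1 HM Rlt_0_1) as [K H1].
destruct (H1 1) as [E1 [HE1 _]].
{ rewrite Cmod_1; lra. }
{ rewrite Cmod_1; lra. }
{ exact far_from_cut_1. }
assert (Hser : is_clim (sum_n (fun n =>
    Clog (RtoC (INR (S n)) + z) / (RtoC (INR (S n)) + z)
      - Clog (RtoC (INR (S n))) / RtoC (INR (S n)))%C)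
  (- (em_sum M z + E) - Clog z / z + (em_sum M 1 + E1))).
(* Both telescoped sums are compared with the same log^2(n+2)/2, which drops out of the
   difference. *)
{ apply is_clim_ext with (fun n =>
    (em_sum M (z + 1 + INR (S n)) - (1 / 2 * ln (INR (S n) + 1) ^ 2)%R)
    - (em_sum M (1 + INR (S n)) - (1 / 2 * ln (INR (S n) + 1) ^ 2)%R)
    - (em_sum M z + sum_n (fun j => em_defect M (z + INR j)) (S n))
    - Clog z / z + (em_sum M 1 + sum_n (fun j => em_defect M (1 + INR j)) n))%C.
  - intros n.
    transitivity (sum_n (fun j => Clog (z + INR j) / (z + INR j))%C (S n) - Clog z / z
      - sum_n (fun j => Clog (1 + INR j) / (1 + INR j))%C n)%C.
    + rewrite !(em_telescope M).
      replace (z + 1 + INR (S n))%C with (z + INR (S (S n)))%C; [ring|].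
      rewrite (S_INR (S n)), RtoC_plus; ring.
    + assert (HS : forall k, (1 + INR k = INR (S k))%C).
      { intros k; rewrite S_INR, RtoC_plus; ring. }
      induction n as [|n IH].
      * rewrite Csum_Sn, !Csum_O, HS.
        rewrite (Cplus_comm _ z); simpl (INR 0); rewrite Cplus_0_r; ring.
      * rewrite (Csum_Sn _ (S n)), (Csum_Sn (fun j => Clog (1 + INR j) / (1 + INR j))%C).
        rewrite (Csum_Sn (fun n0 => Clog (INR (S n0) + z) / _ - _)%C), <- IH.
              rewrite HS, (Cplus_comm (INR (S (S n)))); ring.
  - replace (- (em_sum M z + E) - Clog z / z + (em_sum M 1 + E1))%C with
      (0 - 0 - (em_sum M z + E) - Clog z / z + (em_sum M 1 + E1))%C by ring.
    apply is_clim_plus; [|apply is_clim_plus; [apply is_clim_const|exact HE1]].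
    apply is_clim_minus; [|apply is_clim_const].
    apply is_clim_minus; [|apply is_clim_plus;
      [apply is_clim_const|exact (is_clim_succ _ _ HE)]].
    apply is_clim_minus; [exact (is_clim_succ _ _ (em_sum_asymp M (z + 1)))|
      exact (is_clim_succ _ _ (em_sum_asymp M 1))]. }
assert (HC : CSeries (fun n =>
    Clog (RtoC (INR (S n)) + z) / (RtoC (INR (S n)) + z)
      - Clog (RtoC (INR (S n))) / RtoC (INR (S n)))%C
  = (- (em_sum M z + E) - Clog z / z + (em_sum M 1 + E1))%C).
{ destruct Hser as [Hr Hi]; unfold CSeries.
  rewrite (surjective_pairing (- (em_sum M z + E) - _ + _)%C); f_equal;
    apply is_series_unique, is_series_lim_seq; [revert Hr|revert Hi];
    apply is_lim_seq_ext; intros n; [apply Re_sum_n|apply Im_sum_n]. }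
unfold psi1; rewrite HC, (gamma1_em M E1 HE1); ring.
Qed.


(** * The asymptotic expansion *)

(** With r = |z|, |z+t|^2 >= r^2 + 2 r t cos a + t^2 = (1 + cos a)/2 (r+t)^2 + (1 - cos a)/2
    (r-t)^2. Hence c = sqrt((1 + cos a)/2), which is positive for a < PI. *)
Lemma sector_far_from_cut (alpha : R) : alpha < PI ->
  exists c, 0 < c /\ forall z : C, z <> 0 -> Rabs (Carg z) <= alpha -> far_from_cut c z.
Proof.
intros Ha.
(* Keeps the angle in [0, PI), where the cosine is decreasing. *)
set (a := Rmax 0 alpha).
assert (Ha0 : 0 <= a) by apply Rmax_l.
assert (HaPI : a < PI) by (apply Rmax_lub_lt; [apply PI_RGT_0|exact Ha]).
assert (Hcos : -1 < cos a) by (rewrite <- cos_PI; apply cos_decreasing_1; lra).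
assert (Hc2 : 0 < (1 + cos a) / 2) by lra.
exists (sqrt ((1 + cos a) / 2)); split; [now apply sqrt_lt_R0|].
intros z Hz Hs; apply Cmod_gt_0 in Hz.
assert (E := Cmod2_alt z).
assert (Hx : Cmod z * cos a <= Re z).
{ assert (B : -1 <= Re z / Cmod z <= 1).
  { assert (P := re_le_Cmod z); apply Rabs_le_between in P.
    split; [apply Rle_div_r|apply Rle_div_l]; lra. }
  assert (Hle : Rabs (Carg z) <= a) by (apply Rle_trans with (1 := Hs), Rmax_r).
  assert (P : cos a <= cos (Rabs (Carg z))).
  { assert (Q := Rabs_pos (Carg z)); apply cos_decr_1; lra. }
  rewrite abs_Carg, cos_acos in P by exact B.
  apply Rle_div_r in P; lra. }
assert (Hslit : slit z).
{ unfold slit; destruct (Req_dec (Im z) 0) as [Hi|Hi]; [right|now left].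
  rewrite Hi in E; apply Rnot_le_lt; intros Hr.
  assert (Re z = - Cmod z); [|nra].
  assert (P : (Cmod z - Re z) * (Cmod z + Re z) = 0) by (ring_simplify; lra).
  apply Rmult_integral in P; lra. }
intros t Ht; split; [now apply slit_plus|].
assert (Es := sqrt_sqrt _ (Rlt_le _ _ Hc2)); assert (Hs0 := sqrt_lt_R0 _ Hc2).
apply Rsqr_incr_0_var; [|apply Cmod_ge_0].
assert (E2 := Cmod2_alt (z + t)).
replace (Re (z + t)) with (Re z + t) in E2 by reflexivity.
replace (Im (z + t)) with (Im z) in E2 by (unfold Im; simpl; ring).
set (s := sqrt ((1 + cos a) / 2)) in *; set (r := Cmod z) in *.
unfold Rsqr.
replace (Cmod (z + t) * Cmod (z + t)) with (r ^ 2 + 2 * t * Re z + t ^ 2) by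
  (transitivity (Cmod (z + t) ^ 2); [rewrite E2, E|]; ring).
replace (s * (r + t) * (s * (r + t))) with (s * s * (r + t) ^ 2) by ring.
rewrite Es.
assert (P1 : t * (r * cos a) <= t * Re z) by now apply Rmult_le_compat_l.
assert (P2 : 0 <= (1 - cos a) * (r - t) ^ 2).
{ apply Rmult_le_pos; [assert (P := COS_bound a); lra|apply pow2_ge_0]. }
nra.
Qed.

(** With k = i + 1, (2k-1)!/(2k)! gives 1/(2k), the sign (-1)^(2k-1) turns log z - H into H - log z,
    and the sum in the term together with 1/(2k-1) is the harmonic number H_(2k-1). *)
Lemma psi1_term_even (i : nat) (z : C) : z <> 0 -> psi1_term (S (S i)) z =
  (RtoC (bernoulli_coef (2 * S i)) * log_sq_deriv (2 * S i) z)%C.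
Proof.
intros Hz.
set (m := (2 * i + 1)%nat).
assert (E : harmonic m = sum_n_m (fun j => 1 / INR j) 1 (2 * S i - 2) + 1 / INR (2 * S i - 1)).
{ replace (2 * S i - 2)%nat with (2 * i)%nat by lia.
  replace (2 * S i - 1)%nat with (S (2 * i)) by lia.
  unfold m; rewrite Nat.add_1_r; apply harmonic_S. }
unfold psi1_term; rewrite <- E; unfold bernoulli_coef.
replace (2 * S i)%nat with (S m) by (unfold m; lia).
unfold log_sq_deriv.
replace ((-1) ^ m) with (-1) by (unfold m; rewrite Nat.add_1_r; symmetry; apply pow_1_odd).
assert (HF : INR (fact m) <> 0) by apply INR_fact_neq_0.
assert (HS : INR (S m) <> 0) by (apply not_0_INR; lia).
replace (bernoulli (S m) / INR (fact (S m))) with (bernoulli (S m) / INR (S m) / INR (fact m)).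
2: { rewrite fact_simpl, mult_INR; field; auto. }
assert (HFC : RtoC (INR (fact m)) <> 0) by (intros X; now apply HF, RtoC_inj).
assert (HSC : RtoC (INR (S m)) <> 0) by (intros X; now apply HS, RtoC_inj).
assert (HZC : (z ^ S m <> 0)%C) by now apply Cpow_nz.
rewrite !RtoC_div by assumption.
rewrite RtoC_mult, Cpow_inv by exact Hz.
replace (RtoC (-1)) with (- (1))%C by (rewrite <- RtoC_opp; reflexivity).
field; auto.
Qed.

(** Orders 0 and 1 give the first two terms, with B_1 = -1/2. From then on the odd orders vanish,
    and each new term uses up two orders. *)
Lemma em_sum_psi1_term (m : nat) (z : C) : z <> 0 ->
  em_sum (2 * S m) z = sum_n (fun n => psi1_term n z) (S (S m)).
Proof.
intros Hz; induction m as [|m IH].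
- unfold em_sum; change (2 * 1)%nat with 2%nat.
  rewrite !Csum_Sn, !Csum_O, psi1_term_even by exact Hz.
  change (2 * 1)%nat with 2%nat; f_equal; f_equal.
  + unfold bernoulli_coef, bernoulli, log_sq_deriv, psi1_term; simpl bernoulli_upto.
    simpl (INR (fact 0)); rewrite Rdiv_1_r; ring.
  + unfold log_sq_deriv, psi1_term; rewrite harmonic_0, Cpow_1_r, bernoulli_coef_1.
    replace ((-1) ^ 0 * INR (fact 0)) with 1 by (simpl; ring).
    rewrite RtoC_opp, RtoC_div by lra; field; exact Hz.
- rewrite Csum_Sn, <- IH, psi1_term_even by exact Hz.
  unfold em_sum; replace (2 * S (S m))%nat with (S (S (2 * S m))) by lia.
  rewrite (Csum_Sn _ (S (2 * S m))), (Csum_Sn _ (2 * S m)).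
  replace (bernoulli_coef (S (2 * S m))) with 0; [ring|].
  replace (S (2 * S m)) with (2 * m + 3)%nat by lia.
  symmetry; apply bernoulli_coef_odd.
Qed.

(** * Size of the terms of the expansion *)

Lemma exp_le (x y : R) : x <= y -> exp x <= exp y.
Proof.
intros [H| ->]; [left; now apply exp_increasing|right; reflexivity].
Qed.

Lemma Cmod_Clog_ge (T : R) (z : C) : exp T <= Cmod z -> T <= Cmod (Clog z).
Proof.
intros Hz; apply Rle_trans with (ln (Cmod z)).
- rewrite <- (ln_exp T); apply ln_le; [apply exp_pos|exact Hz].
- apply Rle_trans with (2 := re_le_Cmod _), Rle_abs.
Qed.

(* [|psi1_term n z|] is of order [|log z| / |z| ^ term_order n], up to another
   factor [|log z|] for [n = 0]. *)
Definition term_order (n : nat) : nat :=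
  match n with 0%nat => 0%nat | 1%nat => 1%nat | S k => (2 * k)%nat end.

Lemma psi1_term_even_bounds (i : nat) : exists c d T, 0 < c /\ 0 <= d /\
  forall z, exp T <= Cmod z ->
    c * Cmod (Clog z) / Cmod z ^ (2 * S i) <= Cmod (psi1_term (S (S i)) z)
      <= d * Cmod (Clog z) / Cmod z ^ (2 * S i).
Proof.
set (H := sum_n_m (fun j => 1 / INR j) 1 (2 * S i - 2) + 1 / INR (2 * S i - 1)).
set (a := Rabs (bernoulli (2 * S i)) / INR (2 * S i)).
assert (Hk : 0 < INR (2 * S i)) by (apply lt_0_INR; lia).
assert (Ha : 0 < a).
{ apply Rdiv_lt_0_compat; [apply Rabs_pos_lt|exact Hk].
  replace (2 * S i)%nat with (2 * i + 2)%nat by lia; apply bernoulli_even_neq_0. }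
(* For |log z| >= 2|H| the modulus of H - log z lies between |log z|/2 and 2|log z|. The lower
   constant is positive because B_2k does not vanish. *)
exists (a * / 2), (a * 2), (2 * Rabs H); split; [lra|]; split; [lra|].
intros z Hz; apply Cmod_Clog_ge in Hz as HL.
assert (Hz0 : 0 < Cmod z) by (apply Rlt_le_trans with (2 := Hz), exp_pos).
assert (HP : 0 < / Cmod z ^ (2 * S i)) by (apply Rinv_0_lt_compat, pow_lt, Hz0).
replace (Cmod (psi1_term (S (S i)) z)) with (a * Cmod (H - Clog z) * / Cmod z ^ (2 * S i)).
- assert (P1 := Cmod_triangle H (- Clog z)).
  assert (P2 := Cmod_triangle H (Clog z - H)).
  replace (H + (Clog z - H))%C with (Clog z) in P2 by ring.
  replace (Clog z - H)%C with (- (H - Clog z))%C in P2 by ring.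
  rewrite Cmod_opp, Cmod_R in P1, P2.
  change (H + - Clog z)%C with (H - Clog z)%C in P1.
  unfold Rdiv; rewrite !(Rmult_assoc a).
  split; (apply Rmult_le_compat_l; [lra|apply Rmult_le_compat_r; lra]).
- unfold psi1_term; fold H.
  assert (HzC : (z ^ (2 * S i) <> 0)%C) by now apply Cpow_nz, Cmod_gt_0.
  assert (HkC : RtoC (INR (2 * S i)) <> 0) by (intros X; apply RtoC_inj in X; lra).
  rewrite Cmod_mult, Cmod_div, Cmod_mult, Cmod_pow, !Cmod_R
    by (apply Cmult_neq_0; assumption).
  rewrite (Rabs_pos_eq (INR _)) by lra.
  unfold a; field; split; [|lra]. apply pow_nonzero; lra.
Qed.

Lemma Cmod_psi1_term_1 (z : C) : z <> 0 ->
  Cmod (psi1_term 1 z) = Cmod (Clog z) / (2 * Cmod z).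
Proof.
intros Hz; assert (Hm := proj1 (Cmod_gt_0 z) Hz).
assert (H2 : (RtoC 2 * z <> 0)%C).
{ apply Cmult_neq_0; [intros X; apply RtoC_inj in X; lra|exact Hz]. }
unfold psi1_term; rewrite Cmod_opp, Cmod_mult, Cmod_div, Cmod_mult, !Cmod_R by exact H2.
rewrite !Rabs_pos_eq by lra; field; lra.
Qed.

Lemma psi1_term_lower (n : nat) : exists c T, 0 < c /\
  forall z, exp T <= Cmod z ->
    c * Cmod (Clog z) / Cmod z ^ term_order n <= Cmod (psi1_term n z).
Proof.
destruct n as [|[|i]].
- exists (1 / 2), 1; split; [lra|]; intros z Hz; apply Cmod_Clog_ge in Hz.
  unfold psi1_term; rewrite Cmod_mult, Cmod_pow, Cmod_R, Rabs_pos_eq by lra.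
  simpl; nra.
- exists (1 / 2), 0; split; [lra|]; intros z Hz.
  assert (Hz0 : 0 < Cmod z) by (apply Rlt_le_trans with (2 := Hz), exp_pos).
  rewrite Cmod_psi1_term_1 by now apply Cmod_gt_0.
  apply Req_le; simpl; field; lra.
- destruct (psi1_term_even_bounds i) as [c [d [T [Hc [_ B]]]]].
  exists c, T; split; [exact Hc|]; intros z Hz; now apply B.
Qed.

(** Measured against [psi1_term_lower], each term gains at least one power of z: exactly one for the
    first two steps, two afterwards. *)
Lemma psi1_term_upper (n : nat) : exists d T, 0 <= d /\
  forall z, exp T <= Cmod z ->
    Cmod (psi1_term (S n) z) <= d * Cmod (Clog z) / Cmod z ^ S (term_order n).
Proof.
destruct n as [|n].
- exists (1 / 2), 0; split; [lra|]; intros z Hz.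
  assert (Hz0 : 0 < Cmod z) by (apply Rlt_le_trans with (2 := Hz), exp_pos).
  rewrite Cmod_psi1_term_1 by now apply Cmod_gt_0.
  apply Req_le; simpl; field; lra.
- destruct (psi1_term_even_bounds n) as [c [d [T [_ [Hd B]]]]].
  exists d, (Rmax 0 T); split; [exact Hd|]; intros z Hz.
  assert (Hz1 : 1 <= Cmod z).
  { rewrite <- exp_0; apply Rle_trans with (2 := Hz), exp_le, Rmax_l. }
  assert (HzT : exp T <= Cmod z) by (apply Rle_trans with (2 := Hz), exp_le, Rmax_r).
  apply Rle_trans with (1 := proj2 (B z HzT)).
  apply Rmult_le_compat_l; [apply Rmult_le_pos; [exact Hd|apply Cmod_ge_0]|].
  apply Rinv_le_contravar; [apply pow_lt; lra|].
  apply Rle_pow; [exact Hz1|destruct n; simpl; lia].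
Qed.

(** * Domination along sectors *)

Global Instance sector_infty_filter (alpha : R) : Filter (sector_infty alpha).
Proof.
apply within_filter; split.
- now exists 0.
- intros P Q [A HA] [B HB]; exists (Rmax A B); intros z Hz; split;
    [apply HA|apply HB]; apply Rle_lt_trans with (2 := Hz); [apply Rmax_l|apply Rmax_r].
- intros P Q HPQ [A HA]; exists A; auto.
Qed.

(** The factor |log z| is common to both bounds, so g/f is at most d/(c|z|) and falls below eps once
    |z| exceeds |d|/(c eps). *)
Lemma is_domin_sector (alpha c d T : R) (e : nat) (f g : C -> C_NormedModule) :
  0 < c ->
  (forall z, exp T <= Cmod z -> Rabs (Carg z) <= alpha ->
    c * Cmod (Clog z) / Cmod z ^ e <= Cmod (f z) /\
    Cmod (g z) <= d * Cmod (Clog z) / Cmod z ^ S e) ->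
  is_domin (sector_infty alpha) f g.
Proof.
intros Hc HB eps; assert (Heps := cond_pos eps).
exists (Rmax (exp T) (Rabs d / (c * eps))); intros z Hz Hs.
assert (HzT : exp T <= Cmod z) by (apply Rlt_le, Rle_lt_trans with (2 := Hz), Rmax_l).
assert (Hzd : Rabs d / (c * eps) <= Cmod z)
  by (apply Rlt_le, Rle_lt_trans with (2 := Hz), Rmax_r).
destruct (HB z HzT Hs) as [Hf Hg].
assert (Hz0 : 0 < Cmod z) by (apply Rlt_le_trans with (2 := HzT), exp_pos).
assert (HP : 0 < Cmod z ^ e) by now apply pow_lt.
change (Cmod (g z) <= eps * Cmod (f z)).
apply Rle_trans with (1 := Hg).
apply Rle_trans with (eps * (c * Cmod (Clog z) / Cmod z ^ e));
  [|apply Rmult_le_compat_l; lra].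
apply Rle_div_l in Hzd; [|nra].
assert (Hd := Rle_abs d).
rewrite <- tech_pow_Rmult.
apply Rle_div_l; [nra|].
replace (eps * (c * Cmod (Clog z) / Cmod z ^ e) * (Cmod z * Cmod z ^ e))
  with (Cmod z * (c * eps) * Cmod (Clog z)) by (field; lra).
apply Rmult_le_compat_r; [apply Cmod_ge_0|lra].
Qed.

Lemma psi1_term_domin (alpha : R) (n : nat) :
  is_domin (V := C_NormedModule) (sector_infty alpha) (psi1_term n : C -> C_NormedModule)
    (psi1_term (S n)).
Proof.
destruct (psi1_term_lower n) as [c [T [Hc L]]].
destruct (psi1_term_upper n) as [d [T' [_ U]]].
apply is_domin_sector with c d (Rmax T T') (term_order n); [exact Hc|].
intros z Hz _; split; [apply L|apply U]; apply Rle_trans with (2 := Hz), exp_le;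
  [apply Rmax_l|apply Rmax_r].
Qed.

(** The truncation two terms beyond N corresponds to M = 2(N+1). The sum of defects is then
    O(|z|^(-2N-2)), at least one power of z below term N, for N = 0 and 1 as well. *)
Lemma psi1_remainder_domin (alpha : R) (N : nat) : alpha < PI ->
  is_domin (V := C_NormedModule) (sector_infty alpha) (psi1_term N : C -> C_NormedModule)
    (fun z => (psi1 z - sum_n (fun n => psi1_term n z) (S (S N)))%C).
Proof.
intros Ha.
destruct (sector_far_from_cut alpha Ha) as [c [Hc Hfar]].
destruct (em_defect_series (2 * S N) c ltac:(lia) Hc) as [K HE].
destruct (psi1_term_lower N) as [c' [T [Hc' L]]].
(* The threshold secures the lower bound on term N, |log z| >= 1 to supply the logarithm lacking in
   the defect bound, and c|z| >= 1. *)
apply is_domin_sector with c' (Rabs K) (Rmax T (Rmax 1 (/ c))) (term_order N); [exact Hc'|].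
intros z Hz Hs; set (T' := Rmax T (Rmax 1 (/ c))) in Hz.
assert (HT : T <= T') by apply Rmax_l.
assert (H1 : 1 <= T') by (apply Rle_trans with (2 := Rmax_r _ _), Rmax_l).
assert (H2 : / c <= T') by (apply Rle_trans with (2 := Rmax_r _ _), Rmax_r).
assert (Hexp := exp_ineq1_le T').
split; [apply L; apply Rle_trans with (2 := Hz), exp_le, HT|].
assert (Hz0 : z <> 0) by (apply Cmod_gt_0; lra).
assert (Hcz : 1 <= c * Cmod z).
{ rewrite <- (Rinv_r c) by lra; apply Rmult_le_compat_l; lra. }
destruct (HE z ltac:(lra) Hcz (Hfar z Hz0 Hs)) as [E [HlimE HbE]].
rewrite (psi1_em (2 * S N) z E) by (lia || exact HlimE).
rewrite em_sum_psi1_term by exact Hz0.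
match goal with |- Cmod (?a + E - ?a)%C <= _ => replace (a + E - a)%C with E by ring end.
apply Rle_trans with (1 := HbE).
assert (HL : 1 <= Cmod (Clog z)) by (apply Cmod_Clog_ge, Rle_trans with (2 := Hz), exp_le, H1).
apply Rle_trans with (Rabs K / Cmod z ^ (2 * S N)).
- apply Rmult_le_compat_r; [left; apply Rinv_0_lt_compat, pow_lt; lra|apply Rle_abs].
- assert (HK := Rabs_pos K).
  apply Rmult_le_compat; [exact HK|left; apply Rinv_0_lt_compat, pow_lt; lra|nra|].
  apply Rinv_le_contravar; [apply pow_lt; lra|].
  apply Rle_pow; [lra|destruct N as [|[|N]]; simpl; lia].
Qed.

(** The condition |arg z| < PI is read as uniformity on every closed sector |arg z| <= alpha; the
    constant of [sector_far_from_cut] degenerates as alpha tends to PI. *)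
Theorem theorem3p2 (alpha : R) (halpha : alpha < PI) :
  asymptotic_expansion (V := C_NormedModule) (sector_infty alpha) psi1 psi1_term.
Proof.
split; [apply psi1_term_domin|].
intros N eps.
(* The remainder after term N is the one after term N + 2 plus the terms N + 1 and N + 2, all three
   dominated by term N. *)
assert (D1 := psi1_term_domin alpha N).
assert (D2 := domin_trans _ _ _ D1 (psi1_term_domin alpha (S N))).
assert (D := domin_plus _ _ _ (psi1_remainder_domin alpha N halpha)
  (domin_plus _ _ _ D1 D2)).
generalize (D eps); apply filter_imp; intros z Hz.
apply Rle_trans with (2 := Hz), Req_le, f_equal.
rewrite !Csum_Sn.
change (psi1 z - sum_n (fun n => psi1_term n z) N
  = psi1 z - (sum_n (fun n => psi1_term n z) N + psi1_term (S N) z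
    + psi1_term (S (S N)) z) + (psi1_term (S N) z + psi1_term (S (S N)) z))%C.
ring.
Qed.
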